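(* Let $V\in C_c^\infty(\mathbb R)$ be a nonnegative potential such that $V(x)=V(-x)$ for all $x$; $V(x)=x^2+1$ for $x\in[-1,1]$; $V(x)=4-x$ for $x\in[2,3.5]$; $V(x)<1$ for $x>3$; and $\operatorname{supp}V\subset[-5,5]$. Let $P(h)=-h^2\partial_x^2+V(x)$ on $\mathbb R$. Put $R_0=4$, fix $R>5$, and let $\chi$ be the indicator function of $\{|x|<R_0\}$ and $\psi$ the indicator function of $\{R-1<|x|<R+1\}$. Then there exist $c>0$ and, for all sufficiently small $h>0$, families $E_0(h)\in\mathbb R$ and $u(h),f(h)\in C_c^\infty(\mathbb R)$ such that $E_0(h)=1+\mathcal O(h)$ as $h\to0$ and $$(P(h)-E_0(h))u=f,\quad f=\psi f,\quad \|\chi u\|_{L^2(\mathbb R)}=1,\quad \|f\|_{L^2(\mathbb R)}\le e^{-c/h}.$$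
   Context: Here $h>0$ is a small semiclassical parameter; $V$, $R$ and the constant $c$ do not depend on $h$, and the constant in $\mathcal O(h)$ is independent of $h$. *)

(* Defs.v *)
From mathcomp Require Import all_boot all_order all_algebra.
From mathcomp Require Import all_classical all_reals all_analysis.

Set Implicit Arguments.
Unset Strict Implicit.
Unset Printing Implicit Defensive.

Import Order.TTheory GRing.Theory Num.Theory.
Import numFieldNormedType.Exports.

Local Open Scope classical_set_scope.
Local Open Scope ring_scope.

Definition supp (R : realType) (f : R -> R) : set R :=
  closure [set x | f x != 0].

(* C_c^oo(R), for real-valued functions. The iterated derivative [f^`(n)] is
   total, so smoothness is the derivability of every one of them everywhere. *)
Definition Cc_smooth (R : realType) (f : R -> R) : Prop :=
  (forall (n : nat) (x : R), derivable (f^`(n))%classic x 1) /\ compact (supp f).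

Definition schrodinger (R : realType) (h : R) (V : R -> R) (u : R -> R) :
    R -> R :=
  fun x => - (h ^+ 2 * (u^`(2))%classic x) + V x * u x.

Definition L2norm (R : realType) (g : R -> R) : \bar R :=
  'N[@lebesgue_measure R]_(2%:E) [EFin \o g]%E.

(* Main.v *)
(* Dirichlet shooting.  Fix a = 23/8 in the barrier and let v_E solve
   -h^2 v'' + V v = E v with v_E(a) = 0.  If E can be chosen in [1, 1 + 2h] with
   v_E(0) = 0 or v_E'(0) = 0, then by uniqueness v_E is odd or even, so that
   what happens near a also happens near -a.  The logarithmic derivative
   m(E) = v_E'(0) / v_E(0) satisfies h^2 m' = int_0^a v_E^2 / v_E(0)^2; pairing
   v_E with two explicit test functions bounds m' below, by 1/(49h) throughout
   and, for E near 1 + h, by a large multiple of m^2.  A function m that is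
   finite and nonzero on [1, 1 + 2h] would then blow up, so the desired E
   exists.

   Between 2 and a the solution v_E grows leftwards at rate at least 1/(4h); in
   the short interval [23/8, 25/8] around the turning point 3 it grows
   rightwards at rate at most 1/(2h), which loses less than the barrier gains;
   beyond 25/8 the energy h^2 v'^2 + (E - V) v^2 grows only by a factor
   independent of h.
   Hence v_E is exponentially small, relative to its norm on {|x| < 4}, on
   {r - 1 < |x| < r + 1}, and cutting it off there yields u, with
   f = [P, cutoff] v_E.  The smooth cutoff is built from a primitive of V. *)

Require Import Defs.
From mathcomp Require Import all_boot all_order all_algebra.
From mathcomp Require Import all_classical all_reals all_analysis.
From mathcomp Require Import measurable_realfun ring lra.

Import Order.TTheory GRing.Theory Num.Theory.
Import numFieldNormedType.Exports.

Local Open Scope classical_set_scope.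
Local Open Scope ring_scope.

(** * Calculus *)

Section DerivativeRules.
Context {R : realType}.
Implicit Types (f g : R -> R) (x a b c : R).

Lemma eq_is_derive f x a b : is_derive x 1 f a -> a = b -> is_derive x 1 f b.
Proof. by move=> df <-. Qed.

Lemma is_derive_addf f g x a b : is_derive x 1 f a -> is_derive x 1 g b ->
  is_derive x 1 (fun y => f y + g y) (a + b).
Proof. by move=> df dg; exact: is_deriveD. Qed.

Lemma is_derive_oppf f x a : is_derive x 1 f a ->
  is_derive x 1 (fun y => - f y) (- a).
Proof. by move=> df; exact: is_deriveN. Qed.

Lemma is_derive_mulf f g x a b : is_derive x 1 f a -> is_derive x 1 g b ->
  is_derive x 1 (fun y => f y * g y) (a * g x + f x * b).
Proof.
move=> df dg; have -> : (fun y => f y * g y) = f * g by [].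
by apply: is_derive_eq; rewrite /GRing.scale /=; ring.
Qed.

Lemma is_derive_constf c x : is_derive x 1 (fun=> c) 0.
Proof. exact: is_derive_cst. Qed.

Lemma is_derive_idf x : is_derive x 1 (fun y : R => y) 1.
Proof. exact: is_derive_id. Qed.

Lemma is_derive_expf f n x a : is_derive x 1 f a ->
  is_derive x 1 (fun y => f y ^+ n.+1) (n.+1%:R * f x ^+ n * a).
Proof.
move=> df.
have -> : (fun y => f y ^+ n.+1) = f ^+ n.+1.
  by apply/funext => y; rewrite exprfctE.
by apply: is_derive_eq.
Qed.

Lemma is_derive_compf f g x a b :
  is_derive (f x) 1 g b -> is_derive x 1 f a ->
  is_derive x 1 (fun y => g (f y)) (b * a).
Proof. by move=> dg df; exact: is_derive1_comp. Qed.

Lemma is_derive_oppr f x a : is_derive (- x) 1 f a ->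
  is_derive x 1 (fun y => f (- y)) (- a).
Proof.
move=> df; have d := is_derive_oppf _ x 1 (is_derive_idf x).
apply: eq_is_derive (is_derive_compf (fun y => - y) f x _ _ df d) _.
exact: mulrN1.
Qed.

Lemma is_derive_shift f c x a : is_derive (x + c) 1 f a ->
  is_derive x 1 (fun y => f (y + c)) a.
Proof.
move=> df.
have d := is_derive_addf _ _ x _ _ (is_derive_idf x) (is_derive_constf c x).
apply: eq_is_derive (is_derive_compf (fun y => y + c) f x _ _ df d) _.
by rewrite addr0 mulr1.
Qed.

Lemma is_derive_expRf f x a : is_derive x 1 f a ->
  is_derive x 1 (fun y => expR (f y)) (expR (f x) * a).
Proof. by move=> df; apply: is_derive_compf. Qed.

Lemma is_derive_invf f x a : f x != 0 -> is_derive x 1 f a ->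
  is_derive x 1 (fun y => (f y)^-1) (- a / f x ^+ 2).
Proof.
move=> fx0 df; have H := @is_deriveV _ f x a 1 fx0 df.
apply: is_derive_eq.
by rewrite /GRing.scale /= !mulNr mulrC.
Qed.

End DerivativeRules.

(* [notypeclasses]: otherwise the premises are solved by the library's
   instances, whose derivatives have the wrong shape. *)
Ltac derive_step := first
  [ match goal with
    | H : is_derive ?x _ ?u _ |- is_derive ?x _ _ _ => notypeclasses refine H
    | H : forall x, is_derive x _ ?u _ |- is_derive ?x _ _ _ =>
        notypeclasses refine (H x)
    end
  | notypeclasses refine (is_derive_constf _ _)
  | notypeclasses refine (is_derive_idf _)
  | notypeclasses refine (is_derive_addf _ _ _ _ _ _ _)
  | notypeclasses refine (is_derive_oppf _ _ _ _)
  | notypeclasses refine (is_derive_mulf _ _ _ _ _ _ _)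
  | notypeclasses refine (is_derive_expf _ _ _ _ _)
  | notypeclasses refine (is_derive_expRf _ _ _ _) ].
Ltac derive_rules :=
  notypeclasses refine (eq_is_derive _ _ _ _ _ _); [repeat derive_step | rewrite /=].

(** * Comparison of functions through their derivatives on a segment *)

Section MeanValue.
Context {R : realType}.
Implicit Types (f g df dg : R -> R) (x y t a b : R).

Lemma is_derive_continuous f x d : is_derive x 1 f d -> {for x, continuous f}.
Proof. by move=> df; apply/differentiable_continuous/derivable1_diffP. Qed.

Lemma nondecreasing_segment f df a b : a <= b ->
  (forall x, a <= x <= b -> is_derive x 1 f (df x)) ->
  (forall x, a <= x <= b -> 0 <= df x) -> f a <= f b.
Proof.
move=> ab fd df0.
have [||c cab E] := @MVT_segment R f df a b ab.
- by move=> x; rewrite in_itv /= => /andP[/ltW ? /ltW ?]; apply/fd/andP.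
- apply: continuous_in_subspaceT => x; rewrite inE /= in_itv /= => xab.
  exact: is_derive_continuous (fd _ xab).
- rewrite -subr_ge0 E mulr_ge0 ?subr_ge0 ?df0 //.
Qed.

Lemma le_segment f df g dg a b : a <= b ->
  (forall x, a <= x <= b -> is_derive x 1 f (df x)) ->
  (forall x, a <= x <= b -> is_derive x 1 g (dg x)) ->
  (forall x, a <= x <= b -> df x <= dg x) -> f b - f a <= g b - g a.
Proof.
move=> ab fd gd dle.
have /= := @nondecreasing_segment (fun x => g x - f x) (fun x => dg x - df x)
  a b ab.
have H : (forall x, a <= x <= b ->
  is_derive x 1 (fun x => g x - f x) (dg x - df x)).
  move=> x xab; apply: is_derive_addf; first exact: gd.
  by apply: is_derive_oppf; exact: fd.
move=> /(_ H); have H2 : forall x, a <= x <= b -> 0 <= dg x - df x.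
  by move=> x xab; rewrite subr_ge0 dle.
by move=> /(_ H2); lra.
Qed.

Lemma derive0_eq f x y : (forall t, is_derive t 1 f 0) -> f x = f y.
Proof. by move=> d0; exact: is_derive_0_is_cst. Qed.

End MeanValue.

(** * Primitives of continuous functions on the whole line *)

Section Primitive.
Context {R : realType}.
Implicit Types (f g F : R -> R) (x y a b : R).

Lemma eq_segment f g d a b : a <= b ->
  (forall x, a <= x <= b -> is_derive x 1 f (d x)) ->
  (forall x, a <= x <= b -> is_derive x 1 g (d x)) -> f b - f a = g b - g a.
Proof.
move=> ab fd gd; apply/eqP; rewrite eq_le.
by apply/andP; split; apply: le_segment ab _ _ _ => //; eauto.
Qed.

(** The integral from the fixed base point [- L] is a primitive only to the right of that point, so
    a global primitive has to be glued from these. *)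
Lemma primitive_right f L : continuous f ->
  exists F, forall x, - L < x -> is_derive x 1 F (f x).
Proof.
move=> fc.
exists (fun x => \int[lebesgue_measure]_(t in `[- L, x]) f t)%R => x Lx.
have xu : x < x + 1 by rewrite ltrDl.
have fi : (@lebesgue_measure R).-integrable `[- L, x + 1] (EFin \o f).
  apply: continuous_compact_integrable; first exact: segment_compact.
  exact: continuous_subspaceT.
have [] := @continuous_FTC1_closed R f (- L) x (x + 1) xu fi Lx (fc x).
by move=> /derivableP; rewrite -derive1E => + EF; rewrite EF.
Qed.

(** The integrals from different base points, normalised to vanish at 0, agree wherever both are
    primitives. The value at [x] can thus be read off from one whose base point lies far enough to
    the left. In the shooting argument, integrals appear as increments of such primitives. *)
Lemma primitive f : continuous f ->
  exists2 F, F 0 = 0 & forall x, is_derive x 1 F (f x).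
Proof.
move=> fc.
have /choice[G HG] := fun L => primitive_right f L fc.
pose H L x := G L x - G L 0.
have dH L x : - L < x -> is_derive x 1 (H L) (f x).
  move=> /HG dG; rewrite /H; derive_rules; exact: addr0.
have HE L M x : 0 < L -> L <= M -> - L < x -> H L x = H M x.
  move=> L0 LM Lx.
  have [x0|/ltW x0] := leP 0 x.
    have := @eq_segment (H L) (H M) f 0 x x0.
    rewrite /H !subrr !subr0; apply => y /andP[y0 _]; apply: dH; lra.
  have := @eq_segment (H L) (H M) f x 0 x0.
  have -> : H L 0 = 0 by rewrite /H subrr.
  have -> : H M 0 = 0 by rewrite /H subrr.
  rewrite !sub0r => E; apply: oppr_inj; apply: E => y /andP[xy _]; apply: dH; lra.
(* If [|x - y| < 1] then [|x| + 1 <= |y| + 2], so near [x] the glued function coincides with the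
   single primitive [H (|x| + 1)]. *)
exists (fun x => H (`|x| + 2) x); first by rewrite /H subrr.
move=> x.
have xH : is_derive x 1 (H (`|x| + 1)) (f x).
  by apply: dH; have := ler_norm (- x); rewrite normrN; lra.
apply: (near_eq_is_derive _ xH) => //.
near=> y.
have xy : `|x - y| < 1 by near: y; apply: cvgr_dist_lt => //; exact: cvg_id.
have xyE : `|x| <= `|y| + `|x - y|.
  by rewrite -{1}(subrK y x) addrC ler_normD.
have [A1 A2] := (ler_norm (x - y), ler_norm (- x)); rewrite normrN in A2.
have := normr_ge0 x => ?.
apply: HE; lra.
Unshelve. all: by end_near. Qed.

End Primitive.

(** * Linear second order equations *)

Section LinearODE.
Context {R : realType}.
Implicit Types (f F q u : R -> R) (x y : R).

(** With [e n = 2 C / 2^n] the intervals [[a_ n - e n, a_ n + e n]] are nested, and the supremum of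
    their left ends lies in all of them. *)
Lemma geometric_limit (a_ : nat -> R) (C : R) :
  (forall n, `|a_ n.+1 - a_ n| <= C / 2 ^+ n) ->
  exists l, forall n, `|a_ n - l| <= 2 * C / 2 ^+ n.
Proof.
move=> aC.
pose e n := 2 * C / 2 ^+ n.
have eS n : e n - e n.+1 = C / 2 ^+ n.
  have : (2 ^+ n : R) != 0 by rewrite expf_neq0.
  by rewrite /e exprS => ?; field.
have e0 n : 0 <= e n.
  have C0 : 0 <= C by have := aC 0%N; rewrite expr0 divr1; apply: le_trans.
  by rewrite /e !mulr_ge0 // invr_ge0 exprn_ge0.
have lo n k : a_ n - e n <= a_ (n + k)%N - e (n + k)%N.
  elim: k => [|k IH]; first by rewrite addn0.
  rewrite addnS; have := aC (n + k)%N; rewrite -eS ler_norml => /andP[]; lra.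
have hi n k : a_ (n + k)%N + e (n + k)%N <= a_ n + e n.
  elim: k => [|k IH]; first by rewrite addn0.
  rewrite addnS; have := aC (n + k)%N; rewrite -eS ler_norml => /andP[]; lra.
have lohi n m : a_ n - e n <= a_ m + e m.
  have := lo n m; have := hi m n; rewrite [(m + n)%N]addnC.
  have := e0 (n + m)%N; lra.
exists (sup (range (fun n => a_ n - e n))) => n.
rewrite ler_norml; apply/andP; split.
  suff : sup (range (fun n => a_ n - e n)) <= a_ n + e n by rewrite /e; lra.
  apply: ge_sup; first by exists (a_ 0%N - e 0%N); exists 0%N.
  by move=> _ [m _ <-].
suff : a_ n - e n <= sup (range (fun n => a_ n - e n)) by rewrite /e; lra.
apply: ub_le_sup; last by exists n.
by exists (a_ 0%N + e 0%N) => _ [m _ <-].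
Qed.

(** In the sup norm weighted by [exp (- l |x|)], integration from 0 has norm at most [1 / l]. This
    makes the Picard map a contraction on the whole line at once. *)
Lemma primitive_expR_bound f F (B l : R) : 0 < l -> F 0 = 0 ->
  (forall x, is_derive x 1 F (f x)) ->
  (forall x, `|f x| <= B * expR (l * `|x|)) ->
  forall x, `|F x| <= B / l * expR (l * `|x|).
Proof.
move=> l0.
have B0 (h : R -> R) : (forall x, `|h x| <= B * expR (l * `|x|)) -> 0 <= B.
  by move=> /(_ 0); rewrite normr0 mulr0 expR0 mulr1; apply: le_trans.
have pos f' F' : F' 0 = 0 -> (forall x, is_derive x 1 F' (f' x)) ->
    (forall x, `|f' x| <= B * expR (l * `|x|)) ->
    forall x, 0 <= x -> F' x <= B / l * expR (l * x).
  move=> F0 dF bf x x0.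
  have := @le_segment R F' f' (fun y => B / l * expR (l * y))
    (fun y => B * expR (l * y)) 0 x x0.
  rewrite F0 subr0 mulr0 expR0 mulr1 => H.
  apply: le_trans (_ : _ <= B / l * expR (l * x) - B / l) _.
    apply: H => // y /andP[y0 _]; last first.
      by have := bf y; rewrite (ger0_norm y0) ler_norml => /andP[].
    by derive_rules; field; rewrite gt_eqF.
  by rewrite gerBl divr_ge0 ?(B0 _ bf) // ltW.
move=> F0 dF bf x.
have abspos f' F' : F' 0 = 0 -> (forall x, is_derive x 1 F' (f' x)) ->
    (forall x, `|f' x| <= B * expR (l * `|x|)) ->
    forall x, 0 <= x -> `|F' x| <= B / l * expR (l * x).
  move=> F'0 dF' bf' y y0; rewrite ler_norml; apply/andP; split; last first.
    exact: pos dF' bf' _ y0.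
  rewrite lerNl; apply: (pos (fun x => - f' x) (fun x => - F' x)) => //.
  - by rewrite F'0 oppr0.
  - by move=> z; rewrite normrN.
have [x0|/ltW x0] := leP 0 x.
  by rewrite (ger0_norm x0); exact: abspos dF bf _ x0.
rewrite -(normrN x) -{1}(opprK x) (ger0_norm (_ : 0 <= - x)) ?oppr_ge0 //.
apply: (abspos (fun x => - f (- x)) (fun x => F (- x))).
- by rewrite oppr0.
- by move=> y; exact: is_derive_oppr.
- by move=> y; rewrite normrN -(normrN y).
- by rewrite oppr_ge0.
Qed.

Lemma continuous_is_derive f F :
  (forall x, is_derive x 1 F (f x)) -> continuous F.
Proof. by move=> dF x; exact: is_derive_continuous (dF x). Qed.

Lemma exists_div_exp2_lt (C e : R) : 0 < e -> exists n, C / 2 ^+ n < e.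
Proof.
move=> e0; exists (Num.bound (`|C| / e)).
rewrite ltr_pdivrMr ?exprn_gt0 // mulrC -ltr_pdivrMr //.
apply: le_lt_trans (_ : `|C| / e < _).
  by rewrite ler_pM2r ?invr_gt0 // ler_norm.
apply: lt_trans (archi_boundP _) _; first by rewrite divr_ge0 // ltW.
by rewrite -natrX ltr_nat ltn_expl.
Qed.

Lemma locally_uniform_limit_continuous (s_ : nat -> R -> R) u (M l : R) :
  0 < l -> (forall n, continuous (s_ n)) ->
  (forall n x, `|s_ n x - u x| <= M / 2 ^+ n * expR (l * `|x|)) ->
  continuous u.
Proof.
move=> l0 sc su x; apply/cvgrPdist_lt => e e0.
pose w := expR (l * (`|x| + 1)).
have w0 : 0 < w by exact: expR_gt0.
have M0 : 0 <= M.
  have := su 0%N 0; rewrite normr0 mulr0 expR0 expr0 mulr1 divr1.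
  by apply: le_trans.
have e30 : 0 < e / 3 by rewrite divr_gt0.
have [n nP] := exists_div_exp2_lt (M * w) (e / 3) e30.
have sw y : `|y| <= `|x| + 1 -> `|s_ n y - u y| < e / 3.
  move=> yx; apply: le_lt_trans nP; apply: le_trans (su n y) _.
  rewrite mulrAC ler_pM2r ?invr_gt0 ?exprn_gt0 // ler_wpM2l // ler_expR.
  by rewrite ler_pM2l.
near=> y.
have xy1 : `|x - y| < 1 by near: y; apply: cvgr_dist_lt => //; exact: cvg_id.
have sxy : `|s_ n x - s_ n y| < e / 3.
  by near: y; apply: cvgr_dist_lt => //; exact: sc.
have sx : `|s_ n x - u x| < e / 3 by apply: sw; rewrite lerDl.
have sy : `|s_ n y - u y| < e / 3.
  apply: sw; have : `|y| <= `|x| + `|x - y|.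
    by rewrite -{1}(subrK x y) addrC distrC ler_normD.
  lra.
move: sx sy sxy; rewrite !ltr_norml => /andP[? ?] /andP[? ?] /andP[? ?].
by apply/andP; split; lra.
Unshelve. all: by end_near. Qed.

(** Picard iteration for the twice integrated equation, started at 0. The iterates converge
    geometrically in the weighted norm, hence locally uniformly. *)
Lemma linear_ode_at0 q (K al be : R) : continuous q ->
  (forall x, `|q x| <= K) ->
  exists u u1, [/\ u 0 = al, u1 0 = be, forall x, is_derive x 1 u (u1 x) &
    forall x, is_derive x 1 u1 (q x * u x)].
Proof.
move=> qc qK.
have K0 : 0 <= K by apply: le_trans (qK 0).
(* [I] is a total choice of the primitive vanishing at 0; a discontinuous function is sent to itself
   as a dummy value. *)
have /choice[I IP] : forall f, exists F, continuous f ->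
    F 0 = 0 /\ forall x, is_derive x 1 F (f x).
  move=> f; have [fc|nfc] := pselect (continuous f); last by exists f.
  by have [F F0 dF] := primitive f fc; exists F.
have I0 f : continuous f -> I f 0 = 0 by move=> /IP[].
have dI f : continuous f -> forall x, is_derive x 1 (I f) (f x).
  by move=> /IP[].
have Ic f : continuous f -> continuous (I f).
  by move=> fc; apply: continuous_is_derive (dI f fc).
have qMc f : continuous f -> continuous (fun x => q x * f x).
  by move=> fc x; apply: cvgM; [exact: qc | exact: fc].
pose T f x := al + be * x + I (I (fun y => q y * f y)) x.
have Tc f : continuous f -> continuous (T f).
  move=> fc x; apply: cvgD; last by apply: (Ic _); apply: (Ic _); exact: qMc.
  by apply: cvgD; [exact: cvg_cst | apply: cvgM; [exact: cvg_cst|exact: cvg_id]].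
(* Two integrations and a multiplication by [q] cost [K / l^2], which is at most 1/2 for this
   weight. *)
pose l := K + 1.
have l0 : 0 < l by rewrite /l; lra.
have Kl : K / l / l <= 1 / 2.
  by rewrite ler_pdivrMr // ler_pdivrMr // /l; nra.
have IIb f g (B : R) : continuous f -> continuous g ->
    (forall x, `|f x - g x| <= B * expR (l * `|x|)) ->
    forall x, `|T f x - T g x| <= B / 2 * expR (l * `|x|).
  move=> fc gc fg.
  pose dq x := q x * f x - q x * g x.
  pose D1 x := I (fun y => q y * f y) x - I (fun y => q y * g y) x.
  pose D2 x := I (I (fun y => q y * f y)) x - I (I (fun y => q y * g y)) x.
  have dD1 x : is_derive x 1 D1 (dq x).
    have [A1 A2] := (dI _ (qMc f fc), dI _ (qMc g gc)).
    by rewrite /D1 /dq; derive_rules.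
  have dD2 x : is_derive x 1 D2 (D1 x).
    have [A1 A2] := (dI _ (Ic _ (qMc f fc)), dI _ (Ic _ (qMc g gc))).
    by rewrite /D2 /D1; derive_rules.
  have D10 : D1 0 = 0 by rewrite /D1 !I0 ?subrr //; exact: qMc.
  have D20 : D2 0 = 0 by rewrite /D2 !I0 ?subrr //; apply: (Ic _); exact: qMc.
  have dqb x : `|dq x| <= K * B * expR (l * `|x|).
    rewrite /dq -mulrBr normrM -mulrA.
    by apply: ler_pM.
  have D1b := primitive_expR_bound _ _ _ _ l0 D10 dD1 dqb.
  have D2b := primitive_expR_bound _ _ _ _ l0 D20 dD2 D1b.
  move=> x; have -> : T f x - T g x = D2 x by rewrite /T /D2; ring.
  apply: le_trans (D2b x) _; rewrite ler_pM2r ?expR_gt0 //.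
  have B0 : 0 <= B.
    by have := fg 0; rewrite normr0 mulr0 expR0 mulr1; apply: le_trans.
  have -> : K * B / l / l = B * (K / l / l) by field; rewrite gt_eqF.
  by apply: ler_wpM2l => //; rewrite -(div1r 2).
pose s_ n := iter n T (fun=> 0).
have sc n : continuous (s_ n).
  elim: n => [|n IH]; first by move=> x; exact: cvg_cst.
  exact: Tc.
pose M := `|al| + `|be|.
have s0b x : `|s_ 1%N x - s_ 0%N x| <= M * expR (l * `|x|).
  have zc : continuous (fun y : R => q y * 0).
    by have := qMc _ (sc 0%N).
  have I00 f : continuous f -> (forall y, f y = 0) -> forall y, I f y = 0.
    move=> fc f0 y; rewrite -(I0 f fc); apply: derive0_eq => t.
    by rewrite -(f0 t); exact: dI.
  have E2 : I (I (fun y : R => q y * 0)) x = 0.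
    apply: (I00 _ (Ic _ zc)) => y.
    by apply: (I00 _ zc) => z; rewrite mulr0.
  rewrite /s_ /= /T E2 addr0 subr0.
  apply: le_trans (ler_normD _ _) _; rewrite normrM.
  have := expR_ge1Dx (l * `|x|).
  have : `|x| <= l * `|x| by rewrite ler_peMl // /l; lra.
  have := normr_ge0 x => ? ? ?.
  have W1 : 1 <= expR (l * `|x|) by lra.
  have Wx : `|x| <= expR (l * `|x|) by lra.
  by rewrite /M mulrDl lerD // ?ler_peMr // ler_wpM2l.
have sb n : forall x, `|s_ n.+1 x - s_ n x| <= M / 2 ^+ n * expR (l * `|x|).
  elim: n => [|n IH]; first by rewrite expr0 divr1.
  have -> : M / 2 ^+ n.+1 = M / 2 ^+ n / 2.
    by rewrite exprS; field; rewrite expf_neq0.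
  exact: IIb (sc n.+1) (sc n) IH.
have /choice[u uP] x : exists y, forall n,
    `|s_ n x - y| <= 2 * M / 2 ^+ n * expR (l * `|x|).
  have [|y Hy] := geometric_limit (fun n => s_ n x) (M * expR (l * `|x|)).
    by move=> n; rewrite mulrAC.
  by exists y => n; have := Hy n; rewrite mulrA mulrAC.
have uc : continuous u.
  by apply: (locally_uniform_limit_continuous s_ u (2 * M) l).
(* The distance from [T u] to [u] is split at [s_ n.+1 = T (s_ n)]; both pieces tend to 0. *)
have Tu x : T u x = u x.
  have Tsu n : `|T u x - u x| <= 2 * M / 2 ^+ n * expR (l * `|x|).
    have H1 := IIb _ _ _ (sc n) uc (fun y => uP y n) x.
    have H2 := uP x n.+1.
    rewrite -normrN opprB; apply: le_trans (ler_distD (s_ n.+1 x) _ _) _.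
    have -> : 2 * M / 2 ^+ n * expR (l * `|x|) =
      2 * M / 2 ^+ n.+1 * expR (l * `|x|) + 2 * M / 2 ^+ n / 2 * expR (l * `|x|).
      by rewrite exprS; field; rewrite expf_neq0.
    by rewrite lerD // distrC.
  apply/eqP; rewrite -subr_eq0 -normr_le0; apply/ler_addgt0Pl => e e0.
  have [n Hn] := exists_div_exp2_lt (2 * M * expR (l * `|x|)) e e0.
  by rewrite addr0 (le_trans (Tsu n)) // mulrAC ltW.
exists u, (fun x => be + I (fun y => q y * u y) x).
have dIq := dI _ (qMc u uc).
have dIIq := dI _ (Ic _ (qMc u uc)).
split.
- rewrite -Tu /T I0; last by apply: (Ic _); exact: qMc.
  by rewrite mulr0 !addr0.
- by rewrite I0 ?addr0 //; exact: qMc.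
- move=> x; have dT : is_derive x 1 (T u) (be + I (fun y => q y * u y) x).
    by rewrite /T; derive_rules; ring.
  by rewrite (funext Tu) in dT.
- by move=> x; derive_rules; ring.
Qed.

Lemma linear_ode q (K x0 al be : R) : continuous q ->
  (forall x, `|q x| <= K) ->
  exists u u1, [/\ u x0 = al, u1 x0 = be, forall x, is_derive x 1 u (u1 x) &
    forall x, is_derive x 1 u1 (q x * u x)].
Proof.
move=> qc qK.
have [||u [u1 [u0 u10 du du1]]] := linear_ode_at0 (fun x => q (x + x0)) K al be.
- move=> x; apply: continuous_comp; last exact: qc.
  by apply: cvgD; [exact: cvg_id | exact: cvg_cst].
- by move=> x; exact: qK.
exists (fun x => u (x - x0)), (fun x => u1 (x - x0)); split.
- by rewrite subrr.
- by rewrite subrr.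
- by move=> x; exact: is_derive_shift.
- move=> x; have := du1 (x - x0); rewrite subrK; exact: is_derive_shift.
Qed.

End LinearODE.

(** The equation [u'' = q u] as a first order system: the derivative is carried along as [u1]. *)
Definition ode_solution {R : realType} (q u u1 : R -> R) : Prop :=
  (forall x : R, is_derive x 1 u (u1 x)) /\
  (forall x : R, is_derive x 1 u1 (q x * u x)).

(** * Gronwall estimates, stability, uniqueness and parity of solutions *)

Section EnergyEstimates.
Context {R : realType}.
Implicit Types (f df p q u v w : R -> R) (a b x y C K : R).

(** [f x * exp (- C x)] is nonincreasing. The rate [C] may have either sign; [barrier_growth] uses a
    negative one. *)
Lemma gronwall f df a b C : a <= b ->
  (forall x, a <= x <= b -> is_derive x 1 f (df x)) ->
  (forall x, a <= x <= b -> df x <= C * f x) ->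
  f b <= f a * expR (C * (b - a)).
Proof.
move=> ab fd dfC.
have H : f b * expR (- (C * b)) <= f a * expR (- (C * a)).
  rewrite -lerN2.
  apply: (nondecreasing_segment (fun x => - (f x * expR (- (C * x))))
    (fun x => (C * f x - df x) * expR (- (C * x))) a b ab).
    by move=> x /fd dx; derive_rules; ring.
  by move=> x /dfC dx; rewrite mulr_ge0 ?expR_ge0 // subr_ge0.
move: H; rewrite !expRN ler_pdivrMr ?expR_gt0 // mulrAC.
by rewrite mulrBr expRB mulrA.
Qed.

Lemma gronwall_backward f df a b C : a <= b ->
  (forall x, a <= x <= b -> is_derive x 1 f (df x)) ->
  (forall x, a <= x <= b -> - (C * f x) <= df x) ->
  f a <= f b * expR (C * (b - a)).
Proof.
move=> ab fd dfC.
have H : f a * expR (C * a) <= f b * expR (C * b).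
  apply: (nondecreasing_segment (fun x => f x * expR (C * x))
    (fun x => (C * f x + df x) * expR (C * x)) a b ab).
    by move=> x /fd dx; derive_rules; ring.
  by move=> x /dfC dx; rewrite mulr_ge0 ?expR_ge0 //; lra.
by rewrite mulrBr expRB mulrA ler_pdivlMr ?expR_gt0.
Qed.

Lemma ler_2mul_sqr (r s : R) : `|2 * r * s| <= r ^+ 2 + s ^+ 2.
Proof.
have := sqr_ge0 (r - s); have := sqr_ge0 (r + s).
by rewrite ler_norml sqrrD sqrrB => ? ?; apply/andP; split; lra.
Qed.

(** Stability of solutions with common data at [x0], propagated leftwards. With [e = 0] it yields
    uniqueness; with potentials that differ by a constant it yields Lipschitz dependence on the
    energy. *)
Lemma ode_perturbation q u (u1 : R -> R) p w (w1 : R -> R) (K M e x0 x : R) :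
  0 <= K ->
  x <= x0 -> ode_solution q u u1 -> ode_solution p w w1 ->
  u x0 = w x0 -> u1 x0 = w1 x0 ->
  (forall y, `|p y| <= K) -> (forall y, x <= y <= x0 -> `|u y| <= M) ->
  (forall y, `|p y - q y| <= e) ->
  (w x - u x) ^+ 2 + (w1 x - u1 x) ^+ 2 <=
    (e * M) ^+ 2 * expR ((K + 2) * (x0 - x)).
Proof.
move=> K0 xx0 [du du1] [dw dw1] uw uw1 pK uM pq.
set L := K + 2; have L0 : 0 < L by rewrite /L; lra.
pose D := (e * M) ^+ 2.
pose E y := (w y - u y) ^+ 2 + (w1 y - u1 y) ^+ 2.
pose dE y := 2 * (w y - u y) * (w1 y - u1 y) +
  2 * (w1 y - u1 y) * (p y * w y - q y * u y).
(* Adding the constant [D / L] absorbs the source term: [E' >= - (L E + D)] becomes a homogeneous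
   inequality. *)
have := @gronwall_backward (fun y => E y + D / L) dE x x0 L xx0.
have EX0 : E x0 = 0 by rewrite /E uw uw1 !subrr expr0n addr0.
rewrite EX0 add0r => H.
have : E x + D / L <= D / L * expR (L * (x0 - x)).
  apply: H => y yx; first by rewrite /E; derive_rules; rewrite /dE; ring.
  have -> : dE y = 2 * (w y - u y) * (w1 y - u1 y) * (1 + p y) +
      2 * (w1 y - u1 y) * ((p y - q y) * u y) by rewrite /dE; ring.
  rewrite /E; set d := w y - u y; set d1 := w1 y - u1 y.
  have -> : L * (d ^+ 2 + d1 ^+ 2 + D / L) = L * (d ^+ 2 + d1 ^+ 2) + D.
    by field; rewrite gt_eqF.
  set s := (p y - q y) * u y.
  have sb : `|s| <= e * M by rewrite normrM; apply: ler_pM => //; exact: uM.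
  have s2 : s ^+ 2 <= D.
     rewrite /D -(real_normK (num_real s)).
    by rewrite lerXn2r // ?nnegrE // (le_trans _ sb).
  have A1 : `|2 * d * d1 * (1 + p y)| <= (d ^+ 2 + d1 ^+ 2) * (1 + K).
    rewrite normrM; apply: ler_pM => //; first exact: ler_2mul_sqr.
    by rewrite (le_trans (ler_normD _ _)) // normr1 lerD2l.
  have A2 := ler_2mul_sqr d1 s.
  have d20 := sqr_ge0 d.
  move: A1 A2; rewrite !ler_norml => /andP[A1 _] /andP[A2 _].
  by rewrite /L; lra.
move=> {}H; rewrite -/(E x).
have DL0 : 0 <= D / L by rewrite divr_ge0 ?sqr_ge0 // ltW.
have DL : D / L <= D.
  by rewrite ler_pdivrMr // ler_peMr ?sqr_ge0 // /L; lra.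
apply: le_trans (_ : D / L * expR (L * (x0 - x)) <= _); first by lra.
by rewrite ler_wpM2r ?expR_ge0.
Qed.

Lemma ode_reflect q u (u1 : R -> R) :
  (forall x, q (- x) = q x) -> ode_solution q u u1 ->
  ode_solution q (fun x => u (- x)) (fun x => - u1 (- x)).
Proof.
move=> qe [du du1]; split=> x; first exact: is_derive_oppr.
apply: (eq_is_derive _ _ (- - (q (- x) * u (- x)))).
  by apply: is_derive_oppf; exact: is_derive_oppr.
by rewrite opprK qe.
Qed.

Lemma ode_opp q u (u1 : R -> R) : ode_solution q u u1 ->
  ode_solution q (fun x => - u x) (fun x => - u1 x).
Proof.
move=> [du du1]; split=> x; first exact: is_derive_oppf.
by derive_rules; rewrite mulrN.
Qed.

Lemma ode_unique_left q u (u1 : R -> R) w (w1 : R -> R) K x0 x :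
  (forall y, `|q y| <= K) ->
  x <= x0 -> ode_solution q u u1 -> ode_solution q w w1 ->
  u x0 = w x0 -> u1 x0 = w1 x0 -> u x = w x /\ u1 x = w1 x.
Proof.
move=> qK xx0 su sw uw uw1.
have uc : {within `[x, x0], continuous (fun y => `|u y|)}.
  apply: continuous_subspaceT => y; apply: continuous_comp.
    exact: is_derive_continuous (su.1 y).
  exact: norm_continuous.
have [z _ zM] := EVT_max xx0 uc.
have := @ode_perturbation q u u1 q w w1 K `|u z| 0 x0 x
  (le_trans (normr_ge0 _) (qK 0)) xx0 su sw uw uw1 qK.
rewrite mul0r expr0n mul0r.
have H1 : forall y, x <= y <= x0 -> `|u y| <= `|u z|.
  by move=> y yx; apply: zM; rewrite in_itv.
have H2 : forall y, `|q y - q y| <= 0 by move=> y; rewrite subrr normr0.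
move=> /(_ H1 H2) H.
have [D1 D2] := (sqr_ge0 (w x - u x), sqr_ge0 (w1 x - u1 x)).
split; apply/eqP; rewrite eq_sym -subr_eq0 -sqrf_eq0 eq_le.
  by rewrite D1 andbT; lra.
by rewrite D2 andbT; lra.
Qed.

(** Points to the right of [x0] are reached by reflection, which preserves the equation because [q]
    is even. *)
Lemma ode_unique q u (u1 : R -> R) w (w1 : R -> R) K x0 :
  (forall x, q (- x) = q x) ->
  (forall y, `|q y| <= K) -> ode_solution q u u1 -> ode_solution q w w1 ->
  u x0 = w x0 -> u1 x0 = w1 x0 -> u = w /\ u1 = w1.
Proof.
move=> qe qK su sw uw uw1.
have H x : u x = w x /\ u1 x = w1 x.
  have [xx0|/ltW x0x] := leP x x0; first exact: (@ode_unique_left q _ _ _ _ K x0).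
  have [|||E1 E2] := @ode_unique_left q _ _ _ _ K (- x0) (- x) qK _
    (ode_reflect _ _ _ qe su) (ode_reflect _ _ _ qe sw).
  - by rewrite lerN2.
  - by rewrite opprK.
  - by rewrite opprK uw1.
  by move: E1 E2; rewrite !opprK => -> /oppr_inj.
by split; apply/funext => x; case: (H x).
Qed.

(** The reflected solution has the same data at 0 as [u], so uniqueness identifies the two. *)
Lemma ode_even q u (u1 : R -> R) K : (forall x, q (- x) = q x) ->
  (forall y, `|q y| <= K) -> ode_solution q u u1 -> u1 0 = 0 ->
  forall x, u (- x) = u x /\ u1 (- x) = - u1 x.
Proof.
move=> qe qK su u10 x.
have [||E1 E2] := @ode_unique q _ _ _ _ K 0 qe qK (ode_reflect _ _ _ qe su) su.
- by rewrite oppr0.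
- by rewrite oppr0 u10 oppr0.
have := congr1 (fun f => f x) E1; have := congr1 (fun f => f x) E2.
by rewrite /= => <- ->; rewrite opprK.
Qed.

(** Here the reflected solution has the same data at 0 as [- u]. *)
Lemma ode_odd q u (u1 : R -> R) K : (forall x, q (- x) = q x) ->
  (forall y, `|q y| <= K) -> ode_solution q u u1 -> u 0 = 0 ->
  forall x, u (- x) = - u x /\ u1 (- x) = u1 x.
Proof.
move=> qe qK su u00 x.
have [||E1 E2] := @ode_unique q _ _ _ _ K 0 qe qK (ode_reflect _ _ _ qe su)
  (ode_opp _ _ _ su).
- by rewrite oppr0 u00 oppr0.
- by rewrite oppr0.
have := congr1 (fun f => f x) E1; have := congr1 (fun f => f x) E2.
by rewrite /= => /oppr_inj -> ->.
Qed.

End EnergyEstimates.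

(** * Shooting for the energy *)

Section Riccati.
Context {R : realType}.
Implicit Types (m dm rho f : R -> R).

(** The discriminant argument of the Cauchy-Schwarz inequality: take [t = X / N], or
    [t = (K + 1) / (2 X)] when [N = 0]. *)
Lemma discriminant_le0 (X N K : R) : 0 <= X -> 0 <= N -> 0 <= K ->
  (forall t, 0 < t -> 2 * X * t <= N * t ^+ 2 + K) -> X ^+ 2 <= N * K.
Proof.
move=> X0; rewrite le_eqVlt => /predU1P[<- K0 H|N0 K0 H].
  rewrite mul0r; move: X0; rewrite le_eqVlt => /predU1P[<-|X0].
    by rewrite expr0n.
  have t0 : 0 < (K + 1) / (2 * X) by rewrite divr_gt0 ?mulr_gt0 //; lra.
  have := H _ t0.
  have -> : 2 * X * ((K + 1) / (2 * X)) = K + 1 by field; rewrite gt_eqF.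
  by rewrite mul0r; lra.
move: X0; rewrite le_eqVlt => /predU1P[<-|X0].
  by rewrite expr0n /= mulr_ge0 // ltW.
have := H (X / N) (divr_gt0 X0 N0).
have -> : 2 * X * (X / N) = 2 * (X ^+ 2 / N) by field; rewrite gt_eqF.
have -> : N * (X / N) ^+ 2 = X ^+ 2 / N by field; rewrite gt_eqF.
move=> {}H; have : X ^+ 2 / N <= K by lra.
by rewrite ler_pdivrMr // mulrC.
Qed.

(** Caratheodory's form of the derivative. It fits the Wronskian identity, which gives the
    difference quotient in closed form. *)
Lemma is_derive_quotient f rho (x : R) : {for x, continuous rho} ->
  (\forall y \near x, f y - f x = rho y * (y - x)) ->
  is_derive x 1 f (rho x).
Proof.
move=> rhoc fE; apply/is_derive1_caratheodory.
exists (fun z => if z == x then rho x else (f z - f x) / (z - x)); split.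
- move=> z; case: eqP => [->|/eqP zx]; first by rewrite !subrr mulr0.
  by rewrite divfK // subr_eq0.
- rewrite /prop_for /continuous_at eqxx.
  apply: cvg_trans rhoc; apply: near_eq_cvg.
  near=> z; case: eqP => [->//|/eqP zx].
  have -> : f z - f x = rho z * (z - x) by near: z.
  by rewrite mulfK // subr_eq0.
- by rewrite eqxx.
Unshelve. all: by end_near. Qed.

Lemma nonzero_sign_segment m (a b : R) : a <= b ->
  (forall x, a <= x <= b -> {for x, continuous m}) ->
  (forall x, a <= x <= b -> m x != 0) -> 0 < m b -> 0 < m a.
Proof.
move=> ab mc m0 mb; rewrite ltNge; apply/negP => ma.
have mcs : {within `[a, b], continuous m}.
  by apply: continuous_in_subspaceT => x; rewrite inE /= in_itv /= => /mc.
have [|c] := @IVT R m a b 0 ab mcs.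
  by rewrite ge_min ma /= le_max (ltW mb) orbT.
by rewrite in_itv /= => /m0 /eqP.
Qed.

(* [m' >= b] keeps [m] away from [0] at [e], while [m' >= c m^2] makes [m] blow
   up shortly after [e]. *)
Lemma riccati_positive m dm (e s t b c : R) : 0 < s -> 0 < t -> 0 < c ->
  0 < b ->
  (forall x, e - s <= x <= e + t -> is_derive x 1 m (dm x)) ->
  (forall x, e - s <= x <= e -> b <= dm x) ->
  (forall x, e <= x <= e + t -> c * m x ^+ 2 <= dm x) ->
  (forall x, e - s <= x <= e + t -> 0 < m x) ->
  b * s * (c * t) <= 1.
Proof.
move=> s0 t0 c0 b0 md mb mc m0.
have me : b * s <= m e.
  have := @nondecreasing_segment R (fun x => m x - b * x) (fun x => dm x - b)
    (e - s) e _ _ _.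
  have -> : m e - b * e = m e - b * (e - s) - b * s by ring.
  have H1 : e - s <= e by lra.
  move=> /(_ H1); have := m0 (e - s); move=> m0s H.
  have : m (e - s) - b * (e - s) <= m e - b * (e - s) - b * s.
    apply: H => x xe; last by rewrite subr_ge0 mb.
    have dmx := md x; have {}dmx := dmx ltac:(lra).
    by derive_rules; ring.
  have := m0s ltac:(lra); lra.
have mt : (m e)^-1 >= c * t + (m (e + t))^-1.
  have H1 : e <= e + t by lra.
  have := @nondecreasing_segment R (fun x => - (c * x) - (m x)^-1)
    (fun x => - c + dm x / m x ^+ 2) e (e + t) H1.
  have H2 : forall x, e <= x <= e + t ->
      is_derive x 1 (fun x => - (c * x) - (m x)^-1) (- c + dm x / m x ^+ 2).
    move=> x xe; have dmx := md x ltac:(lra).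
    have mx : m x != 0 by rewrite gt_eqF // m0; lra.
    have dinv := is_derive_invf m x _ mx dmx.
    by derive_rules; field.
  move=> /(_ H2) H.
  have : - (c * e) - (m e)^-1 <= - (c * (e + t)) - (m (e + t))^-1.
    apply: H => x xe; have mx : 0 < m x by apply: m0; lra.
    by rewrite addrC subr_ge0 ler_pdivlMr ?exprn_gt0 // mc.
  lra.
have me0 : 0 < m e by apply: m0; lra.
have mt0 : 0 < (m (e + t))^-1 by rewrite invr_gt0 m0; lra.
have ct : c * t <= (m e)^-1 by lra.
apply: le_trans (_ : m e * (m e)^-1 <= 1); last by rewrite divff ?gt_eqF.
by apply: ler_pM => //; rewrite mulr_ge0 ?ltW.
Qed.

(** Without a zero [m] keeps one sign. A positive [m] contradicts [riccati_positive] directly. A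
    negative one does so after passing to [- m (- x)], which preserves both differential
    inequalities. *)
Lemma riccati_root m dm (e s t b c : R) : 0 < t <= s -> 0 < c -> 0 < b ->
  (forall x, e - s <= x <= e + s -> is_derive x 1 m (dm x)) ->
  (forall x, e - s <= x <= e + s -> b <= dm x) ->
  (forall x, e - t <= x <= e + t -> c * m x ^+ 2 <= dm x) ->
  1 < b * s * (c * t) -> exists2 x, e - s <= x <= e + s & m x = 0.
Proof.
move=> /andP[t0 ts] c0 b0 md mb mc bsct.
apply: contrapT => nroot.
have m0 x : e - s <= x <= e + s -> m x != 0.
  by move=> xe; apply/eqP => mx; apply: nroot; exists x.
have s0 : 0 < s by lra.
have ndecr x y : e - s <= x -> x <= y -> y <= e + s -> m x <= m y.
  move=> ex xy ye; apply: (nondecreasing_segment m dm x y xy) => z zxy.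
    by apply: md; lra.
  by apply: le_trans (mb z _); [exact: ltW | lra].
have contm x : e - s <= x <= e + s -> {for x, continuous m}.
  by move=> /md; exact: is_derive_continuous.
suff : b * s * (c * t) <= 1 by lra.
have [me|me] : 0 < m e \/ m e < 0.
  by have := m0 e ltac:(lra); rewrite neq_lt => /orP[]; [right | left].
- apply: (riccati_positive m dm e s t b c) => // x xe.
  + by apply: md; lra.
  + by apply: mb; lra.
  + by apply: mc; lra.
  + have [xe'|/ltW ex] := leP x e.
      apply: (nonzero_sign_segment m x e) => // y yxe.
        by apply: contm; lra.
      by apply: m0; lra.
    by apply: lt_le_trans me _; apply: ndecr; lra.
- apply: (riccati_positive (fun x => - m (- x)) (fun x => dm (- x)) (- e) s t b c)
    => // x xe.
  + apply: (eq_is_derive _ _ (- - dm (- x))); last by rewrite opprK.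
    by apply: is_derive_oppf; apply: is_derive_oppr; apply: md; lra.
  + by apply: mb; lra.
  + by rewrite sqrrN; apply: mc; lra.
  + have [xe'|/ltW ex] := leP x (- e); last first.
      by rewrite oppr_gt0; apply: le_lt_trans me; apply: ndecr; lra.
    apply: (nonzero_sign_segment (fun x => - m (- x)) x (- e)).
    * exact: xe'.
    * move=> y yxe; apply: continuousN; apply: continuous_comp.
        exact: opp_continuous.
      by apply: contm; lra.
    * by move=> y yxe; rewrite oppr_eq0; apply: m0; lra.
    * by rewrite opprK oppr_gt0.
Qed.

End Riccati.

(** The coefficient [q] for which [u'' = q u] means [(P(h) - E) u = 0]. *)
Definition reduced_potential {R : realType} (V : R -> R) (h E : R) : R -> R :=
  fun x => (V x - E) / h ^+ 2.

(** * Lower bounds for the mass of a solution by pairing with test functions *)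

Section TestFunctions.
Context {R : realType}.
Implicit Types (q v S g V : R -> R) (x y t : R).

(** Green's identity: [v g' - v' g] has derivative [v (g'' - q g)], and its boundary term at [b]
    vanishes. Cauchy-Schwarz then bounds the boundary term at 0, where [S] is a primitive of
    [v^2]. *)
Lemma test_function_bound q v (v1 : R -> R) S g (g1 g2 : R -> R) (b k N : R) :
  0 <= b -> ode_solution q v v1 ->
  (forall x : R, is_derive x 1 S (v x ^+ 2)) ->
  (forall x : R, is_derive x 1 g (g1 x)) ->
  (forall x : R, is_derive x 1 g1 (g2 x)) ->
  g b = 0 -> g1 b = 0 ->
  (forall x, 0 <= x <= b -> `|g2 x - q x * g x| <= k) -> S b - S 0 <= N ->
  (v1 0 * g 0 - v 0 * g1 0) ^+ 2 <= N * (k ^+ 2 * b).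
Proof.
move=> b0 [dv dv1] dS dg dg1 gb g1b kP SN.
set X := v1 0 * g 0 - v 0 * g1 0.
have S0 : 0 <= S b - S 0.
  rewrite subr_ge0; apply: (nondecreasing_segment S (fun x => v x ^+ 2)) => //.
  by move=> x _; exact: sqr_ge0.
rewrite -(real_normK (num_real X)).
apply: discriminant_le0 => //; first exact: le_trans SN.
  by rewrite mulr_ge0 ?sqr_ge0.
move=> t t0.
pose W x := v x * g1 x - v1 x * g x.
have dW x : is_derive x 1 W (v x * (g2 x - q x * g x)).
  by rewrite /W; derive_rules; ring.
have WX : W b - W 0 = X by rewrite /W gb g1b /X; ring.
pose M x := t ^+ 2 * S x + k ^+ 2 * x.
have dM x : is_derive x 1 M (t ^+ 2 * v x ^+ 2 + k ^+ 2).
  by rewrite /M; derive_rules; ring.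
have MN : M b - M 0 <= N * t ^+ 2 + k ^+ 2 * b.
  have -> : M b - M 0 = (S b - S 0) * t ^+ 2 + k ^+ 2 * b by rewrite /M; ring.
  by rewrite lerD2r ler_wpM2r ?sqr_ge0.
have key x : 0 <= x <= b ->
    `|2 * (t * v x) * (g2 x - q x * g x)| <= t ^+ 2 * v x ^+ 2 + k ^+ 2.
  move=> /kP kx; apply: le_trans (ler_2mul_sqr _ _) _.
  rewrite exprMn lerD2l -(real_normK (num_real (g2 x - _))).
  by rewrite lerXn2r // ?nnegrE // (le_trans _ kx).
(* The inequality [2 t v k' <= t^2 v^2 + k^2], for [k' = g'' - q g], is integrated by comparing
   primitives; [W2] is the same with the opposite sign. *)
have W1 : 2 * t * W b - 2 * t * W 0 <= M b - M 0.
  apply: (le_segment (fun x => 2 * t * W x)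
    (fun x => 2 * t * (v x * (g2 x - q x * g x))) M
    (fun x => t ^+ 2 * v x ^+ 2 + k ^+ 2) 0 b b0) => x xb //.
  by have := key x xb; rewrite ler_norml => /andP[_]; lra.
have W2 : - (2 * t * W b) - - (2 * t * W 0) <= M b - M 0.
  apply: (le_segment (fun x => - (2 * t * W x))
    (fun x => - (2 * t * (v x * (g2 x - q x * g x)))) M
    (fun x => t ^+ 2 * v x ^+ 2 + k ^+ 2) 0 b b0) => x xb //.
  by have := key x xb; rewrite ler_norml => /andP[]; lra.
have -> : 2 * `|X| * t = `|2 * t * X|.
  by rewrite normrM ger0_norm ?mulr_ge0 // ?ltW //; ring.
apply: le_trans MN; rewrite ler_norml -WX; apply/andP; split; lra.
Qed.

Lemma sqr_expRN_le2 (y : R) : 0 <= y -> y ^+ 2 * expR (- y) <= 2.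
Proof.
move=> y0; rewrite expRN ler_pdivrMr ?expR_gt0 //.
have := @expR_ge1Dxn R y 1 y0; have -> : (2`!)%:R = 2 :> R by [].
have -> : y ^+ 2 / 2 = 1 / 2 * y ^+ 2 by field.
lra.
Qed.

Lemma expRN_le1 (y : R) : 0 <= y -> y * expR (- y) <= 1.
Proof.
move=> y0; rewrite expRN ler_pdivrMr ?expR_gt0 // mul1r.
by have := expR_ge1Dx y; lra.
Qed.

(* [(1 - x^4)^2 exp(- x^2 / 2h)] is an approximate eigenfunction of the
   harmonic oscillator at energy [1 + h]. *)
Lemma even_test_function V (h E a : R) v (v1 : R -> R) S : 0 < h -> 1 <= a ->
  (forall x, -1 <= x <= 1 -> V x = x ^+ 2 + 1) ->
  ode_solution (reduced_potential V h E) v v1 ->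
  (forall x : R, is_derive x 1 S (v x ^+ 2)) ->
  h ^+ 4 * v1 0 ^+ 2 <=
    (S a - S 0) * (`|E - (1 + h)| + 200 * h ^+ 3) ^+ 2.
Proof.
move=> h0 a1 Vwell sv dS.
have hn0 : h != 0 by rewrite gt_eqF.
pose l := (2 * h)^-1.
have hl : 2 * h * l = 1 by rewrite /l; field.
(* [(1 - x^4)^2] vanishes to second order at 1 and differs from 1 by order [x^4] at 0. Since [x^2]
   is of size [h] under the Gaussian, cutting off costs only order [h^3]. *)
pose p x : R := 1 - 2 * x ^+ 4 + x ^+ 8.
pose p1 x : R := - 8 * x ^+ 3 + 8 * x ^+ 7.
pose p2 x : R := - 24 * x ^+ 2 + 56 * x ^+ 6.
pose G x : R := expR (- (l * x ^+ 2)).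
pose g x := p x * G x.
pose g1 x := (p1 x - 2 * l * x * p x) * G x.
pose g2 x :=
  (p2 x - 4 * l * x * p1 x - 2 * l * p x + 4 * l ^+ 2 * x ^+ 2 * p x) * G x.
have dg x : is_derive x 1 g (g1 x).
  by rewrite /g /G /p; derive_rules; rewrite /g1 /G /p /p1; ring.
have dg1 x : is_derive x 1 g1 (g2 x).
  by rewrite /g1 /G /p /p1; derive_rules; rewrite /g2 /G /p /p1 /p2; ring.
have p_1 : p 1 = 0 by rewrite /p !expr1n; ring.
have p1_1 : p1 1 = 0 by rewrite /p1 !expr1n; ring.
have gb : g 1 = 0 by rewrite /g p_1 mul0r.
have g1b : g1 1 = 0 by rewrite /g1 p_1 p1_1; ring.
pose d := `|E - (1 + h)| + 200 * h ^+ 3.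
have kP x : 0 <= x <= 1 ->
    `|g2 x - reduced_potential V h E x * g x| <= d / h ^+ 2.
  move=> /andP[x0 x1]; rewrite /reduced_potential Vwell; last by lra.
  have -> : g2 x - (x ^+ 2 + 1 - E) / h ^+ 2 * g x =
      (h ^+ 2 * p2 x - 2 * h * (x * p1 x) + (E - (1 + h)) * p x) * G x / h ^+ 2.
    by rewrite /g2 /g /l; field.
  rewrite normrM normfV [`|h ^+ 2|]ger0_norm ?sqr_ge0 //.
  rewrite ler_pM2r ?invr_gt0 ?exprn_gt0 //.
  rewrite normrM [`|G x|]ger0_norm ?expR_ge0 //.
  (* In terms of [y = x^2 / (2 h)] each [x^2] becomes [2 h y], and the Gaussian [exp (- y)] absorbs
     the powers of [y]. The errors sum to [64 h^3 + 128 h^3], below [200 h^3]. *)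
  pose y := l * x ^+ 2.
  have y0 : 0 <= y by rewrite /y mulr_ge0 ?sqr_ge0 // invr_ge0; lra.
  have x2y : x ^+ 2 = 2 * h * y by rewrite /y mulrA hl mul1r.
  have x2 : 0 <= x ^+ 2 <= 1 by rewrite sqr_ge0 expr_le1.
  have x4 : x ^+ 4 = (x ^+ 2) ^+ 2 by rewrite -exprM.
  have x4b : 0 <= x ^+ 4 <= x ^+ 2 by rewrite x4; nra.
  have x8 : x ^+ 8 = x ^+ 4 * x ^+ 4 by rewrite -exprD.
  have x6 : x ^+ 6 = x ^+ 4 * x ^+ 2 by rewrite -exprD.
  have G0 : 0 < G x by exact: expR_gt0.
  have G1 : G x <= 1 by rewrite /G expR_le1 oppr_le0.
  have yG : y * G x <= 1 by exact: expRN_le1.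
  have y2G : y ^+ 2 * G x <= 2 by exact: sqr_expRN_le2.
  have pb : `|p x| <= 1 by rewrite ler_norml /p x8; nra.
  have p2b : `|p2 x| <= 32 * x ^+ 2 by rewrite ler_norml /p2 x6; nra.
  have xp1b : `|x * p1 x| <= 8 * x ^+ 4.
    have -> : x * p1 x = - 8 * x ^+ 4 + 8 * (x ^+ 4 * x ^+ 4) by rewrite /p1; ring.
    by rewrite ler_norml; nra.
  apply: le_trans (_ : (h ^+ 2 * (32 * x ^+ 2) + 2 * h * (8 * x ^+ 4) +
      `|E - (1 + h)|) * G x <= _).
    rewrite ler_pM2r //; apply: le_trans (ler_normD _ _) _; apply: lerD.
      apply: le_trans (ler_normB _ _) _; apply: lerD.
        by rewrite normrM ger0_norm ?sqr_ge0 // ler_wpM2l ?sqr_ge0.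
      have h20 : 0 <= 2 * h by lra.
      by rewrite normrM (ger0_norm h20) ler_wpM2l.
    by rewrite normrM ler_piMr.
  rewrite x4 x2y.
  have -> : (h ^+ 2 * (32 * (2 * h * y)) + 2 * h * (8 * (2 * h * y) ^+ 2) +
      `|E - (1 + h)|) * G x = 64 * h ^+ 3 * (y * G x) +
      64 * h ^+ 3 * (y ^+ 2 * G x) + `|E - (1 + h)| * G x by ring.
  have h30 : 0 < h ^+ 3 by rewrite exprn_gt0.
  have A1 : h ^+ 3 * (y * G x) <= h ^+ 3 * 1 by rewrite ler_pM2l.
  have A2 : h ^+ 3 * (y ^+ 2 * G x) <= h ^+ 3 * 2 by rewrite ler_pM2l.
  have A3 : `|E - (1 + h)| * G x <= `|E - (1 + h)| by rewrite ler_piMr.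
  by rewrite /d; clear - A1 A2 A3 h30; lra.
have SN : S 1 - S 0 <= S a - S 0.
  rewrite lerD2r; apply: (nondecreasing_segment S (fun x => v x ^+ 2)) => //.
  by move=> x _; exact: sqr_ge0.
have := test_function_bound _ v v1 S g g1 g2 1 _ _ ler01 sv dS
  dg dg1 gb g1b kP SN.
have -> : g 0 = 1.
  by rewrite /g /p /G !expr0n /= !mulr0 oppr0 expR0; ring.
have -> : g1 0 = 0 by rewrite /g1 /p1 /p !expr0n /=; ring.
rewrite mulr1 mulr0 subr0 mulr1 => H.
have -> : (S a - S 0) * (`|E - (1 + h)| + 200 * h ^+ 3) ^+ 2 =
    h ^+ 4 * ((S a - S 0) * (d / h ^+ 2) ^+ 2) by rewrite -/d; field.
by rewrite ler_pM2l ?exprn_gt0.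
Qed.

(** The test function [x (1 - x / h)^2] on [[0, h]] has value 0 and slope 1 at 0, so the pairing
    isolates [v 0]. There [|g''| <= 4 / h] and [|q g| <= 3 / h], so that [k = 7 / h] and
    [k^2 h = 49 / h]. *)
Lemma odd_test_function V (h E a : R) v (v1 : R -> R) S :
  0 < h -> h <= 1 -> 1 <= a -> 1 <= E <= 1 + 2 * h ->
  (forall x, -1 <= x <= 1 -> V x = x ^+ 2 + 1) ->
  ode_solution (reduced_potential V h E) v v1 ->
  (forall x : R, is_derive x 1 S (v x ^+ 2)) ->
  v 0 ^+ 2 <= (S a - S 0) * (49 / h).
Proof.
move=> h0 h1 a1 Eb Vwell sv dS.
have hn0 : h != 0 by rewrite gt_eqF.
pose l := h^-1; have hl : h * l = 1 by rewrite /l divff.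
have l0 : 0 < l by rewrite invr_gt0.
pose g x : R := x * (1 - l * x) ^+ 2.
pose g1 x : R := 1 - 4 * l * x + 3 * l ^+ 2 * x ^+ 2.
pose g2 x : R := - 4 * l + 6 * l ^+ 2 * x.
have dg x : is_derive x 1 g (g1 x).
  by rewrite /g; derive_rules; rewrite /g1; ring.
have dg1 x : is_derive x 1 g1 (g2 x).
  by rewrite /g1; derive_rules; rewrite /g2; ring.
have gb : g h = 0 by rewrite /g mulrC [l * h]mulrC hl subrr expr0n mul0r.
have g1b : g1 h = 0 by rewrite /g1 /l; field.
have kP x : 0 <= x <= h ->
    `|g2 x - reduced_potential V h E x * g x| <= 7 * l.
  move=> /andP[x0 xh]; rewrite /reduced_potential Vwell; last by lra.
  have x2 : x ^+ 2 <= h by nra.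
  have lx : 0 <= l * x <= 1.
    by rewrite mulr_ge0 //= ?(ltW l0) // /l mulrC ler_pdivrMr // mul1r.
  have g2b : `|g2 x| <= 4 * l.
    have -> : g2 x = l * (6 * (l * x) - 4) by rewrite /g2; ring.
    by rewrite normrM (gtr0_norm l0) mulrC ler_pM2r // ler_norml; lra.
  have gb' : `|g x| <= h.
    have H : 0 <= (1 - l * x) ^+ 2 <= 1 by rewrite sqr_ge0 expr_le1 //; lra.
    by rewrite /g normrM (ger0_norm x0) ger0_norm; nra.
  have qb : `|(x ^+ 2 + 1 - E) / h ^+ 2| <= 3 * l ^+ 2 * h.
    rewrite normrM normfV [`|h ^+ 2|]ger0_norm ?sqr_ge0 //.
    have -> : 3 * l ^+ 2 * h = 3 * h / h ^+ 2 by rewrite /l; field.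
    rewrite ler_pM2r ?invr_gt0 ?exprn_gt0 // ler_norml.
    by have := sqr_ge0 x; lra.
  apply: le_trans (ler_normB _ _) _.
  have -> : 7 * l = 4 * l + 3 * l by ring.
  apply: lerD => //; rewrite normrM.
  apply: le_trans (_ : 3 * l ^+ 2 * h * h <= _); first exact: ler_pM.
  have -> : 3 * l ^+ 2 * h * h = 3 * (h * l) ^+ 2 by ring.
  by rewrite hl expr1n mulr1 ler_peMr // /l invf_ge1.
have SN : S h - S 0 <= S a - S 0.
  rewrite lerD2r; apply: (nondecreasing_segment S (fun x => v x ^+ 2)).
    exact: le_trans a1.
  by move=> x _; exact: sqr_ge0.
have := test_function_bound _ v v1 S g g1 g2 h _ _ (ltW h0) sv dS
  dg dg1 gb g1b kP SN.
have -> : g 0 = 0 by rewrite /g mul0r.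
have -> : g1 0 = 1 by rewrite /g1 !mulr0 expr0n /= mulr0; ring.
rewrite mulr0 sub0r mulr1 sqrrN.
have -> : (7 * l) ^+ 2 * h = 49 / h by rewrite /l; field.
by [].
Qed.

End TestFunctions.

(** * Dependence of the shooting solution on the energy *)

Section Shooting.
Context {R : realType}.
Implicit Types (f u v w V S P : R -> R) (x y t : R).

Lemma locally_lipschitz_continuous f x (L : R) :
  (forall y, `|y - x| <= 1 -> `|f y - f x| <= L * `|y - x|) ->
  {for x, continuous f}.
Proof.
move=> fL; apply/cvgrPdist_lt => e e0.
have L0 : 0 <= L.
  have := fL (x + 1); rewrite addrAC subrr add0r normr1 mulr1 => /(_ (lexx 1)).
  by apply: le_trans.
have eL : 0 < e / (L + 1) by rewrite divr_gt0 // ltr_wpDl.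
near=> y.
have y1 : `|y - x| <= 1.
  by rewrite distrC ltW //; near: y; apply: cvgr_dist_lt => //; exact: cvg_id.
have ye : `|y - x| < e / (L + 1).
  by rewrite distrC; near: y; exact: (nbhsx_ballx x _ eL).
rewrite distrC; apply: le_lt_trans (fL y y1) _.
apply: le_lt_trans (_ : (L + 1) * `|y - x| < e).
  by rewrite ler_wpM2r // lerDl.
by rewrite mulrC -ltr_pdivlMr // ltr_wpDl.
Unshelve. all: by end_near. Qed.

(** The Wronskian has derivative [(E' - E) / h^2 * u w] and vanishes at [a], where both solutions
    do. *)
Lemma wronskian_energy V (h E E' a : R) u (u1 : R -> R) w (w1 : R -> R) P :
  ode_solution (reduced_potential V h E) u u1 ->
  ode_solution (reduced_potential V h E') w w1 ->
  (forall x, is_derive x 1 P (u x * w x)) -> u a = 0 -> w a = 0 ->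
  u1 0 * w 0 - u 0 * w1 0 = (E - E') / h ^+ 2 * (P a - P 0).
Proof.
move=> [du du1] [dw dw1] dP ua wa.
pose X x := u1 x * w x - u x * w1 x - (E' - E) / h ^+ 2 * P x.
have dX x : is_derive x 1 X 0.
  by rewrite /X; derive_rules; rewrite /reduced_potential; ring.
have := derive0_eq X 0 a dX; rewrite /X ua wa => H.
have -> : (E - E') / h ^+ 2 * (P a - P 0) =
  (E' - E) / h ^+ 2 * P 0 - (E' - E) / h ^+ 2 * P a by ring.
lra.
Qed.

Context (V : R -> R) (B h a : R) (v v1 : R -> R -> R)
  (VB : forall x, `|V x| <= B) (h0 : 0 < h) (a0 : 0 <= a)
  (sv : forall E, ode_solution (reduced_potential V h E) (v E) (v1 E))
  (va : forall E, v E a = 0) (v1a : forall E, v1 E a = 1).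

Lemma solution_bounded (E : R) :
  exists M, forall x, 0 <= x <= a -> `|v E x| <= M.
Proof.
have uc : {within `[0, a], continuous (fun y => `|v E y|)}.
  apply: continuous_subspaceT => y; apply: continuous_comp.
    exact: is_derive_continuous ((sv E).1 y).
  exact: norm_continuous.
have [z _ zM] := EVT_max a0 uc.
by exists `|v E z| => y yx; apply: zM; rewrite in_itv.
Qed.

(** The solutions share their data at [a] and their potentials differ by the constant
    [(E - E') / h^2]. Restricting to [|E' - E| <= 1] gives a single bound [K] for all the
    potentials. *)
Lemma solution_lipschitz_energy (E : R) : exists L, forall E', `|E' - E| <= 1 ->
  forall x, 0 <= x <= a -> `|v E' x - v E x| <= L * `|E' - E|.
Proof.
have [M MP] := solution_bounded E.
have M0 : 0 <= M by apply: le_trans (MP 0 _) => //; rewrite lexx.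
have B0 : 0 <= B by exact: le_trans (VB 0).
pose K := (B + `|E| + 1) / h ^+ 2.
have h20 : 0 < h ^+ 2 by rewrite exprn_gt0.
have K0 : 0 <= K.
  by rewrite divr_ge0 ?(ltW h20) //; have := normr_ge0 E; lra.
pose W := expR ((K + 2) * a).
have W1 : 1 <= W by rewrite -expR0 ler_expR mulr_ge0 //; lra.
exists (M * W / h ^+ 2) => E' EE x /andP[x0 xa].
have redE y E1 E2 : reduced_potential V h E1 y - reduced_potential V h E2 y =
    (E2 - E1) / h ^+ 2 by rewrite /reduced_potential; ring.
have H := @ode_perturbation R _ _ _ _ _ _ K M (`|E' - E| / h ^+ 2) a x K0 xa
  (sv E) (sv E').
have {H}H : (v E' x - v E x) ^+ 2 + (v1 E' x - v1 E x) ^+ 2 <=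
    (`|E' - E| / h ^+ 2 * M) ^+ 2 * expR ((K + 2) * (a - x)).
  apply: H; rewrite ?va ?v1a //.
  - move=> y; rewrite /reduced_potential /K normrM normfV (gtr0_norm h20).
    rewrite ler_pM2r ?invr_gt0 //; apply: le_trans (ler_normB _ _) _.
    have := VB y; have : `|E'| <= `|E' - E| + `|E|.
      by rewrite -{1}(subrK E E') ler_normD.
    lra.
  - by move=> y /andP[xy ya]; apply: MP; rewrite (le_trans x0 xy).
  - by move=> y; rewrite redE normrM normfV (gtr0_norm h20) distrC.
have s1 := sqr_ge0 (v1 E' x - v1 E x).
(* As [W >= 1], the exponential factor may be replaced by [W^2], which makes the bound a perfect
   square. *)
have WX : expR ((K + 2) * (a - x)) <= W ^+ 2.
  apply: le_trans (_ : W <= _); last by rewrite expr2 ler_peMr // (le_trans ler01).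
  rewrite ler_expR ler_wpM2l //; lra.
have : (v E' x - v E x) ^+ 2 <= (M * W / h ^+ 2 * `|E' - E|) ^+ 2.
  have -> : (M * W / h ^+ 2 * `|E' - E|) ^+ 2 =
    (`|E' - E| / h ^+ 2 * M) ^+ 2 * W ^+ 2 by ring.
  apply: le_trans (_ : _ <= (`|E' - E| / h ^+ 2 * M) ^+ 2 *
    expR ((K + 2) * (a - x))) _; first lra.
  by rewrite ler_wpM2l ?sqr_ge0.
rewrite -(real_normK (num_real (v E' x - _))) ler_pXn2r // nnegrE //.
by rewrite !mulr_ge0 ?invr_ge0 ?(ltW h20) //; lra.
Qed.

(** By the Wronskian identity the difference quotient between [e] and [E] is the integral of
    [v e * v E] over [[0, a]], divided by [h^2 * v e 0 * v E 0]. This is continuous in [e] at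
    [E]. *)
Lemma is_derive_log_derivative_energy (E : R) S : v E 0 != 0 ->
  (forall x, is_derive x 1 S (v E x ^+ 2)) ->
  is_derive E 1 (fun e => v1 e 0 / v e 0)
    ((S a - S 0) / (h ^+ 2 * v E 0 ^+ 2)).
Proof.
move=> vE0 dS.
have vc e : continuous (v e) by exact: continuous_is_derive (sv e).1.
have /choice[P dP] e : exists P, forall x, is_derive x 1 P (v e x * v E x).
  have [|P _ dP] := @primitive R (fun x => v e x * v E x); last by exists P.
  by move=> x; apply: cvgM; exact: vc.
have [M MP] := solution_bounded E.
have M0 : 0 <= M by apply: le_trans (MP 0 _) => //; rewrite lexx.
have [L LP] := solution_lipschitz_energy E.
pose J e := P e a - P e 0.
have JS : J E = S a - S 0.
  by apply: (eq_segment (P E) S (fun x => v E x ^+ 2)) => // x _; exact: dP.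
have Jlip e : `|e - E| <= 1 -> `|J e - J E| <= L * M * a * `|e - E|.
  move=> eE.
  have bd x : 0 <= x <= a ->
      `|v e x * v E x - v E x * v E x| <= L * `|e - E| * M.
    by move=> xa; rewrite -mulrBl normrM ler_pM // ?LP ?MP.
  pose D x := P e x - P E x.
  have dD x : is_derive x 1 D (v e x * v E x - v E x * v E x).
    by apply: is_derive_addf => //; exact: is_derive_oppf.
  pose Li x := L * `|e - E| * M * x.
  have dLi x : is_derive x 1 Li (L * `|e - E| * M).
    by rewrite /Li; derive_rules; ring.
  have -> : J e - J E = D a - D 0 by rewrite /J /D; ring.
  have -> : L * M * a * `|e - E| = Li a - Li 0 by rewrite /Li; ring.
  rewrite ler_norml; apply/andP; split.
    rewrite lerNl opprB.
    have -> : D 0 - D a = (fun x => - D x) a - (fun x => - D x) 0.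
      by rewrite /=; ring.
    apply: (le_segment (fun x => - D x)
      (fun x => - (v e x * v E x - v E x * v E x)) Li
      (fun=> L * `|e - E| * M) 0 a a0) => // x xa.
    by have := bd x xa; rewrite ler_norml => /andP[]; lra.
  apply: (le_segment D (fun x => v e x * v E x - v E x * v E x) Li
    (fun=> L * `|e - E| * M) 0 a a0) => // x xa.
  by have := bd x xa; rewrite ler_norml => /andP[].
have Jc : {for E, continuous J} by exact: locally_lipschitz_continuous Jlip.
have v0c : {for E, continuous (fun e => v e 0)}.
  by apply: (@locally_lipschitz_continuous _ E L) => e eE; apply: LP => //;
    rewrite lexx.
pose rho e := J e / (h ^+ 2 * (v e 0 * v E 0)).
have hv0 : h ^+ 2 * (v E 0 * v E 0) != 0.
  by rewrite !mulf_neq0 // gt_eqF // exprn_gt0.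
have -> : (S a - S 0) / (h ^+ 2 * v E 0 ^+ 2) = rho E by rewrite /rho JS expr2.
apply: is_derive_quotient.
  apply: cvgM; first exact: Jc.
  apply: cvgV => //; apply: cvgM; first exact: cvg_cst.
  by apply: cvgM; [exact: v0c | exact: cvg_cst].
near=> e.
have ve0 : v e 0 != 0.
  by near: e; apply: (cvgr_neq0 (v E 0)).
have H := wronskian_energy _ _ _ _ a _ _ _ _ _
  (sv e) (sv E) (dP e) (va e) (va E).
have -> : v1 e 0 / v e 0 - v1 E 0 / v E 0 =
   (v1 e 0 * v E 0 - v e 0 * v1 E 0) / (v e 0 * v E 0).
  by field; rewrite ve0 vE0.
by rewrite H /rho -/(J e); field; rewrite ve0 vE0 gt_eqF.
Unshelve. all: by end_near. Qed.

End Shooting.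

(** If neither [v E 0] nor [v1 E 0] vanished for any [E] in [[1, 1 + 2 h]], the logarithmic
    derivative [m] would be differentiable without zeros there, against [riccati_root] centred at
    [1 + h]. *)
Lemma dirichlet_energy {R : realType} (V : R -> R) (B h a : R) : continuous V ->
  (forall x, `|V x| <= B) -> (forall x, -1 <= x <= 1 -> V x = x ^+ 2 + 1) ->
  0 < h -> 200 * 200 * h < 1 -> 1 <= a ->
  exists E u u1, [/\ 1 <= E <= 1 + 2 * h,
    ode_solution (reduced_potential V h E) u u1, u a = 0, u1 a = 1 &
    u 0 = 0 \/ u1 0 = 0].
Proof.
move=> Vc VB Vwell h0 hs a1.
have a0 : 0 <= a by lra.
have h20 : 0 < h ^+ 2 by rewrite exprn_gt0.
have hn0 : h != 0 by rewrite gt_eqF.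
have /choice[v /choice[v1 vP]] : forall E, exists u u1, [/\ u a = 0, u1 a = 1 &
    ode_solution (reduced_potential V h E) u u1].
  move=> E.
  have [||u [u1 [ua u1a du du1]]] := @linear_ode R (reduced_potential V h E)
    ((B + `|E|) / h ^+ 2) a 0 1; last by exists u, u1.
  - move=> x; apply: cvgM; last exact: cvg_cst.
    by apply: cvgB; [exact: Vc | exact: cvg_cst].
  - move=> x; rewrite /reduced_potential normrM normfV (gtr0_norm h20).
    rewrite ler_pM2r ?invr_gt0 // (le_trans (ler_normB _ _)) // lerD2r.
    exact: VB.
have va E : v E a = 0 by case: (vP E).
have v1a E : v1 E a = 1 by case: (vP E).
have sv E : ode_solution (reduced_potential V h E) (v E) (v1 E) by case: (vP E).
apply: contrapT => nE.
have nz E : 1 <= E <= 1 + 2 * h -> v E 0 != 0 /\ v1 E 0 != 0.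
  by move=> Eb; split; apply/eqP => z; apply: nE; exists E, (v E), (v1 E);
    split=> //; [left | right].
have /choice[S dS] : forall E, exists S,
    forall x : R, is_derive x 1 S (v E x ^+ 2).
  move=> E; have [|S _ dS] := @primitive R (fun x => v E x ^+ 2);
    last by exists S.
  apply: (@continuous_is_derive R (fun x => 2 * v E x * v1 E x)) => x.
  by have [dv _] := sv E; derive_rules; ring.
pose m e := v1 e 0 / v e 0.
pose dm e := (S e a - S e 0) / (h ^+ 2 * v e 0 ^+ 2).
pose eta := 200 * h ^+ 3.
have eta0 : 0 < eta by rewrite mulr_gt0 ?ltr0n ?exprn_gt0.
have eta20 : 0 < (2 * eta) ^+ 2 by rewrite exprn_gt0 ?mulr_gt0 ?ltr0n.
have [h1 h200] : h <= 1 /\ 200 * h <= 1 by clear - h0 hs; split; lra.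
have etah : eta <= h.
  rewrite /eta; have -> : 200 * h ^+ 3 = h * (200 * h * h) by ring.
  apply: ler_piMr; first exact: ltW.
  exact: le_trans (ler_piMl (ltW h0) h200) h1.
(* Within [eta] of [1 + h] the even test function bounds [h^4 v'(0)^2] by [(2 eta)^2] times the
   integral of [v^2]; dividing by [h^2 v(0)^2] turns this into [m' >= c m^2]. *)
pose c := h ^+ 2 / (2 * eta) ^+ 2.
have [E Eb mE] : exists2 E, (1 + h) - h <= E <= (1 + h) + h & m E = 0.
  apply: (@riccati_root R m dm (1 + h) h eta (1 / (49 * h)) c).
  - by rewrite eta0.
  - exact: divr_gt0.
  - by rewrite divr_gt0 // mulr_gt0.
  - move=> E Eb; have [vE0 _] := nz E ltac:(lra).
    exact: (is_derive_log_derivative_energy _ _ _ _ _ _ VB h0 a0 sv va v1a).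
  - move=> E Eb; have [vE0 _] := nz E ltac:(lra).
    have v20 : 0 < v E 0 ^+ 2 by rewrite lt_def sqr_ge0 andbT expf_neq0.
    have Eb' : 1 <= E <= 1 + 2 * h by lra.
    have H := odd_test_function V h E a (v E) (v1 E) (S E) h0 h1 a1 Eb' Vwell
      (sv E) (dS E).
    rewrite /dm ler_pdivlMr ?(mulr_gt0 h20 v20) //.
    have -> : 1 / (49 * h) * (h ^+ 2 * v E 0 ^+ 2) = h / 49 * v E 0 ^+ 2.
      by field.
    apply: le_trans (_ : h / 49 * ((S E a - S E 0) * (49 / h)) <= _).
      by rewrite ler_wpM2l // divr_ge0 // ltW.
    by rewrite le_eqVlt; apply/orP; left; apply/eqP; field.
  - move=> E Eb; have [vE0 _] := nz E ltac:(lra).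
    have v20 : 0 < v E 0 ^+ 2 by rewrite lt_def sqr_ge0 andbT expf_neq0.
    have H := even_test_function V h E a (v E) (v1 E) (S E) h0 a1 Vwell
      (sv E) (dS E).
    rewrite /dm ler_pdivlMr ?(mulr_gt0 h20 v20) // /c /m.
    have -> : h ^+ 2 / (2 * eta) ^+ 2 * (v1 E 0 / v E 0) ^+ 2 *
      (h ^+ 2 * v E 0 ^+ 2) = h ^+ 4 * v1 E 0 ^+ 2 / (2 * eta) ^+ 2.
      by field; rewrite vE0 gt_eqF.
    rewrite (ler_pdivrMr _ _ eta20); apply: le_trans H _.
    have SN : 0 <= S E a - S E 0.
      rewrite subr_ge0.
      apply: (nondecreasing_segment (S E) (fun x => v E x ^+ 2)) => //.
      by move=> x _; exact: sqr_ge0.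
    rewrite -/eta; have dE : `|E - (1 + h)| <= eta by rewrite ler_norml; lra.
    have d0 := normr_ge0 (E - (1 + h)).
    apply: ler_wpM2l => //; rewrite lerXn2r ?nnegrE //;
      by clear - dE d0 eta0; lra.
  (* This is where [200 * 200 * h < 1] enters: the product exceeds 1. *)
  - have -> : 1 / (49 * h) * h * (c * eta) = (200 * 196 * h)^-1.
      by rewrite /c /eta; field.
    have hp : 0 < 200 * 196 * h by clear - h0; lra.
    by rewrite (invf_gt1 hp); clear - hs h0; lra.
have [vE0 v1E0] := nz E ltac:(lra).
by move/eqP: mE; rewrite /m mulf_eq0 invr_eq0 (negbTE vE0) (negbTE v1E0).
Qed.

(** * Propagation through the barrier and beyond *)

Section Propagation.
Context {R : realType}.
Implicit Types (q u V : R -> R) (x y : R).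

(** The product [u u'] increases to 0 at [a], so it is nonpositive before [a]. Hence
    [u'^2 - k^2 u^2] is nonincreasing and at least its final value 1. This gives both
    [(u u')' >= 1], whence [u^2 >= (a - b)^2] at [b], and [(u^2)' <= - 2 k u^2], which is
    exponential growth to the left of [b]. *)
Lemma barrier_growth q u (u1 : R -> R) (k a b x : R) : 0 < k -> x <= b -> b <= a ->
  ode_solution q u u1 -> u a = 0 -> u1 a = 1 ->
  (forall y, x <= y <= a -> k ^+ 2 <= q y) ->
  (a - b) ^+ 2 * expR (2 * k * (b - x)) <= u x ^+ 2.
Proof.
move=> k0 xb ba [du du1] ua u1a qk.
have k20 : 0 < k ^+ 2 by rewrite exprn_gt0.
have dprod y : is_derive y 1 (fun y => u y * u1 y) (u1 y ^+ 2 + q y * u y ^+ 2).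
  by derive_rules; ring.
have prod_le0 y : x <= y <= a -> u y * u1 y <= 0.
  move=> /andP[xy ya].
  have <- : u a * u1 a = 0 by rewrite ua mul0r.
  apply: (nondecreasing_segment (fun y => u y * u1 y)
    (fun y => u1 y ^+ 2 + q y * u y ^+ 2)) => // z /andP[yz za].
  rewrite addr_ge0 ?sqr_ge0 // mulr_ge0 ?sqr_ge0 // (le_trans (ltW k20)) // qk //.
  by rewrite (le_trans xy).
have energy y : x <= y <= a -> 1 + k ^+ 2 * u y ^+ 2 <= u1 y ^+ 2.
  move=> /andP[xy ya].
  have : - (u1 y ^+ 2 - k ^+ 2 * u y ^+ 2) <= - (u1 a ^+ 2 - k ^+ 2 * u a ^+ 2).
    apply: (nondecreasing_segment (fun y => - (u1 y ^+ 2 - k ^+ 2 * u y ^+ 2))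
      (fun y => - (2 * (u y * u1 y) * (q y - k ^+ 2)))) => // z.
      by move=> _; derive_rules; ring.
    move=> /andP[yz za]; have xza : x <= z <= a by rewrite (le_trans xy).
    have := qk z xza; have := prod_le0 z xza; nra.
  by rewrite ua u1a expr1n expr0n /= mulr0; lra.
have prod_le y : x <= y <= a -> u y * u1 y <= y - a.
  move=> /andP[xy ya].
  have := @le_segment R (fun y => y) (fun=> 1) (fun y => u y * u1 y)
    (fun y => u1 y ^+ 2 + q y * u y ^+ 2) y a ya.
  rewrite ua mul0r => H.
  suff : a - y <= 0 - u y * u1 y by lra.
  apply: H => // z /andP[yz za].
  have xza : x <= z <= a by rewrite (le_trans xy).
  have := energy z xza; have := qk z xza; have := sqr_ge0 (u z); nra.
have dsq y : is_derive y 1 (fun y => u y ^+ 2) (2 * (u y * u1 y)).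
  by derive_rules; ring.
have ub : (a - b) ^+ 2 <= u b ^+ 2.
  have := @le_segment R (fun y => u y ^+ 2) (fun y => 2 * (u y * u1 y))
    (fun y => (y - a) ^+ 2) (fun y => 2 * (y - a)) b a ba.
  rewrite ua subrr expr0n /= => H.
  suff : 0 - u b ^+ 2 <= 0 - (b - a) ^+ 2 by rewrite -[a - b]opprB sqrrN; lra.
  apply: H => // z /andP[bz za].
    by derive_rules; ring.
  by rewrite ler_pM2l // prod_le // (le_trans xb).
have := @gronwall R (fun y => u y ^+ 2) (fun y => 2 * (u y * u1 y)) x b
  (- (2 * k)) xb.
have -> : - (2 * k) * (b - x) = - (2 * k * (b - x)) by ring.
rewrite expRN ler_pdivlMr ?expR_gt0 // => H.
apply: le_trans (H _ _) => //.
  by rewrite ler_wpM2r ?expR_ge0.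
move=> y /andP[xy yb]; have xya : x <= y <= a by rewrite xy (le_trans yb).
have En := energy y xya; have Pn := prod_le0 y xya.
suff : k * u y ^+ 2 <= - (u y * u1 y) by lra.
have ku0 : 0 <= k * u y ^+ 2 by rewrite mulr_ge0 ?sqr_ge0 // ltW.
rewrite -ler_sqr ?nnegrE ?oppr_ge0 //.
have -> : (k * u y ^+ 2) ^+ 2 = u y ^+ 2 * (k ^+ 2 * u y ^+ 2) by ring.
by rewrite sqrrN exprMn ler_wpM2l ?sqr_ge0 //; lra.
Qed.

(** The derivative of [u'^2 + s^2 u^2] is [2 u' u (q + s^2)], where [|q + s^2| <= 2 s^2] and
    [2 |u' s u| <= u'^2 + s^2 u^2]. *)
Lemma energy_growth q u (u1 : R -> R) (s a b : R) : 0 < s -> a <= b ->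
  ode_solution q u u1 -> (forall x, a <= x <= b -> `|q x| <= s ^+ 2) ->
  u1 b ^+ 2 + s ^+ 2 * u b ^+ 2 <=
    (u1 a ^+ 2 + s ^+ 2 * u a ^+ 2) * expR (2 * s * (b - a)).
Proof.
move=> s0 ab [du du1] qs.
apply: (gronwall (fun x => u1 x ^+ 2 + s ^+ 2 * u x ^+ 2)
  (fun x => 2 * u1 x * u x * (q x + s ^+ 2))) => // x xab.
  by derive_rules; ring.
have := qs x xab; rewrite ler_norml => /andP[q1 q2].
have -> : 2 * s * (u1 x ^+ 2 + s ^+ 2 * u x ^+ 2) =
  (u1 x ^+ 2 + (s * u x) ^+ 2) / s * (2 * s ^+ 2) by field; rewrite gt_eqF.
apply: le_trans (ler_norm _) _; rewrite normrM ler_pM //.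
  rewrite ler_pdivlMr // -(gtr0_norm s0) -normrM (gtr0_norm s0).
  have -> : 2 * u1 x * u x * s = 2 * u1 x * (s * u x) by ring.
  exact: ler_2mul_sqr.
by rewrite ger0_norm; lra.
Qed.

(** The terms in [u u'] cancel in the derivative of the energy and leave [- V' u^2], so the rate
    [C / c] does not involve [h]. *)
Lemma allowed_region V (V1 : R -> R) (h E c C a b : R) u (u1 : R -> R) :
  0 < h -> 0 < c -> a <= b ->
  ode_solution (reduced_potential V h E) u u1 ->
  (forall x, is_derive x 1 V (V1 x)) ->
  (forall x, a <= x <= b -> `|V1 x| <= C) ->
  (forall x, a <= x <= b -> c <= E - V x) ->
  h ^+ 2 * u1 b ^+ 2 + (E - V b) * u b ^+ 2 <=
    (h ^+ 2 * u1 a ^+ 2 + (E - V a) * u a ^+ 2) * expR (C / c * (b - a)).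
Proof.
move=> h0 c0 ab [du du1] dV V1C EV.
apply: (gronwall (fun x => h ^+ 2 * u1 x ^+ 2 + (E - V x) * u x ^+ 2)
  (fun x => - (V1 x * u x ^+ 2))) => // x xab.
  by derive_rules; rewrite /reduced_potential; field; rewrite gt_eqF.
have C0 : 0 <= C by apply: le_trans (V1C x xab).
have := V1C x xab; rewrite ler_norml => /andP[V1C' _].
have u20 := sqr_ge0 (u x); have u120 := sqr_ge0 (u1 x).
apply: le_trans (_ : C * u x ^+ 2 <= _); first by nra.
have -> : C * u x ^+ 2 = C / c * (c * u x ^+ 2) by field; rewrite gt_eqF.
rewrite ler_wpM2l ?divr_ge0 ?(ltW c0) //.
apply: le_trans (_ : (E - V x) * u x ^+ 2 <= _).
  by rewrite ler_wpM2r // EV.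
by rewrite lerDr mulr_ge0 ?sqr_ge0.
Qed.

End Propagation.

(** * The solution inside the well compared with the solution outside *)

Section Quasimode.
Context {R : realType}.

(** Exponents are counted in units of [1 / (16 h)]: normalised at 23/8, [u^2] gains 5 units across
    the barrier, while [u^2] and [u1^2] gain at most 4 units beyond the turning point. The surplus
    unit is the source of the exponential smallness. *)
Lemma tunnelling_solution (V V1 : R -> R) (B C c b : R) :
  (forall x, 0 <= V x <= B) ->
  (forall x : R, is_derive x 1 V (V1 x)) -> (forall x, `|V1 x| <= C) ->
  (forall x, -1 <= x <= 1 -> V x = x ^+ 2 + 1) ->
  (forall x, 2 <= x <= 7 / 2 -> V x = 4 - x) ->
  0 < c -> (forall x, 25 / 8 <= x -> V x <= 1 - c) ->
  exists2 A, 0 < A & forall h, 0 < h -> 200 * 200 * h < 1 ->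
    exists E u u1, [/\ 1 <= E <= 1 + 2 * h,
      ode_solution (reduced_potential V h E) u u1,
      u 0 = 0 \/ u1 0 = 0,
      forall x, 2 <= x <= 17 / 8 -> expR (5 / (16 * h)) / 64 <= u x ^+ 2 &
      forall x, 25 / 8 <= x <= b -> u x ^+ 2 <= A * expR (4 / (16 * h)) /\
        u1 x ^+ 2 <= A * expR (4 / (16 * h))].
Proof.
move=> VB dV V1C Vwell Vslope c0 Vc.
have C0 : 0 <= C by apply: le_trans (V1C 0).
pose W := expR (C / c * (b - 25 / 8)).
have W0 : 0 < W by exact: expR_gt0.
exists (9 * W * (1 + 1 / c)).
  by rewrite !mulr_gt0 // addr_gt0 // divr_gt0.
move=> h h0 hs.
have hn0 : h != 0 by rewrite gt_eqF.
have h1 : h <= 1 by lra.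
have Vcont : continuous V by exact: continuous_is_derive dV.
have VB' x : `|V x| <= B by have := VB x => /andP[V0 ?]; rewrite ger0_norm.
have [|E [u [u1 [Eb su ua u1a u0]]]] :=
  dirichlet_energy V B h (23 / 8) Vcont VB' Vwell h0 hs; first lra.
have qE x : reduced_potential V h E x = (V x - E) / h ^+ 2 by [].
have h20 : 0 < h ^+ 2 by rewrite exprn_gt0.
exists E, u, u1; split=> //.
  move=> x /andP[x2 xb].
  (* On [[2, 23/8]] one has [V >= 9/8] and [E <= 1 + 2 h], hence [V - E >= 1/16] and
     [k = 1 / (4 h)]. The distance from 22/8 to 17/8 contributes [2 k * 5/8 = 5 / (16 h)]. *)
  have k0 : 0 < (4 * h)^-1 by rewrite invr_gt0 mulr_gt0.
  have := barrier_growth _ _ _ (4 * h)^-1 (23 / 8) (22 / 8) x k0 _ _ su ua u1a.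
  have A1 : x <= 22 / 8 by lra.
  have A2 : 22 / 8 <= 23 / 8 :> R by lra.
  move=> /(_ A1 A2) H; apply: le_trans (H _).
    have -> : (23 / 8 - 22 / 8) ^+ 2 = 1 / 64 :> R by field.
    rewrite mulrC -[X in X * _]div1r ler_pM2l ?divr_gt0 // ler_expR.
    have -> : 5 / (16 * h) = (4 * h)^-1 * (5 / 4) by field.
    have -> : 2 * (4 * h)^-1 * (22 / 8 - x) = (4 * h)^-1 * (2 * (22 / 8 - x)).
      by ring.
    by rewrite ler_pM2l //; lra.
  move=> y /andP[xy ya]; rewrite qE Vslope; last lra.
  have -> : (4 * h)^-1 ^+ 2 = 1 / 16 / h ^+ 2 by field.
  by rewrite ler_pM2r ?invr_gt0 //; lra.
(* On [[23/8, 25/8]] one has [|V - E| <= 1/4], hence [s = 1 / (2 h)]; the length 1/4 gives the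
   exponent [2 s / 4 = 4 / (16 h)]. *)
have s0 : 0 < (2 * h)^-1 by rewrite invr_gt0 mulr_gt0.
have ab : 23 / 8 <= 25 / 8 :> R by lra.
have {s0} := energy_growth _ _ _ (2 * h)^-1 (23 / 8) (25 / 8) s0 ab su.
rewrite ua u1a expr1n expr0n /= mulr0 addr0 mul1r => H.
have {H}Eg : u1 (25 / 8) ^+ 2 + (2 * h)^-1 ^+ 2 * u (25 / 8) ^+ 2 <=
    expR (4 / (16 * h)).
  have -> : 4 / (16 * h) = 2 * (2 * h)^-1 * (25 / 8 - 23 / 8) by field.
  apply: H => y /andP[ay yb]; rewrite qE Vslope; last lra.
  rewrite normrM normfV (gtr0_norm h20).
  have -> : (2 * h)^-1 ^+ 2 = 1 / 4 / h ^+ 2 by field.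
  by rewrite ler_pM2r ?invr_gt0 // ler_norml; lra.
set e := expR (4 / (16 * h)) in Eg *.
move=> x /andP[ax xb].
have EV y : 25 / 8 <= y <= x -> c <= E - V y.
  by move=> /andP[ay _]; have := Vc y ay; lra.
pose G y := h ^+ 2 * u1 y ^+ 2 + (E - V y) * u y ^+ 2.
have := allowed_region V V1 h E c C (25 / 8) x u u1 h0 c0 ax su dV
  (fun y _ => V1C y) EV.
have WX : expR (C / c * (x - 25 / 8)) <= W.
  by rewrite ler_expR ler_wpM2l ?divr_ge0 ?(ltW c0) //; lra.
rewrite -/(G x) -/(G (25 / 8)) => GG0.
have u20 := sqr_ge0 (u (25 / 8)); have u120 := sqr_ge0 (u1 (25 / 8)).
(* The factor 9 is chosen so that [9 h^2 / (2 h)^2 = 9/4] dominates [E - V]. *)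
have G0e : G (25 / 8) <= 9 * h ^+ 2 * e.
  apply: le_trans (_ : 9 * h ^+ 2 *
      (u1 (25 / 8) ^+ 2 + (2 * h)^-1 ^+ 2 * u (25 / 8) ^+ 2) <= _); last first.
    by rewrite ler_pM2l // mulr_gt0.
  have -> : 9 * h ^+ 2 * (u1 (25 / 8) ^+ 2 + (2 * h)^-1 ^+ 2 * u (25 / 8) ^+ 2) =
    h ^+ 2 * u1 (25 / 8) ^+ 2 + 8 * (h ^+ 2 * u1 (25 / 8) ^+ 2) +
    9 / 4 * u (25 / 8) ^+ 2 by field.
  have h2u := mulr_ge0 (ltW h20) u120.
  have : (E - V (25 / 8)) * u (25 / 8) ^+ 2 <= 9 / 4 * u (25 / 8) ^+ 2.
    by rewrite ler_wpM2r //; have /andP[] := VB (25 / 8); lra.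
  by rewrite /G; lra.
have e0 : 0 < e by exact: expR_gt0.
have Ge : G x <= 9 * h ^+ 2 * e * W.
  apply: le_trans GG0 _; apply: ler_pM => //.
  apply: addr_ge0; first by rewrite mulr_ge0 // ltW.
  rewrite mulr_ge0 //; apply: le_trans (ltW c0) _; apply: EV; lra.
have c1 : 0 < 1 / c by rewrite divr_gt0.
have ux0 := sqr_ge0 (u x); have u1x0 := sqr_ge0 (u1 x).
have EVx : c <= E - V x by apply: EV; rewrite ax /=.
have We : 0 <= 9 * (e * W) by rewrite !mulr_ge0 ?ltW.
split.
  rewrite -(ler_pM2l c0); apply: le_trans (_ : G x <= _).
    rewrite /G; apply: le_trans (_ : (E - V x) * u x ^+ 2 <= _).
      by rewrite ler_wpM2r.
    by rewrite lerDr mulr_ge0 // ltW.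
  apply: le_trans Ge _.
  have -> : c * (9 * W * (1 + 1 / c) * e) = 9 * (e * W) * (c + 1).
    by field; rewrite gt_eqF.
  have -> : 9 * h ^+ 2 * e * W = 9 * (e * W) * h ^+ 2 by ring.
  by rewrite ler_wpM2l //; nra.
rewrite -(ler_pM2l h20); apply: le_trans (_ : G x <= _).
  by rewrite lerDl mulr_ge0 // (le_trans (ltW c0)).
apply: le_trans Ge _.
have -> : h ^+ 2 * (9 * W * (1 + 1 / c) * e) = 9 * (e * W) * (h ^+ 2 * (1 + 1 / c)).
  by field; rewrite gt_eqF.
have -> : 9 * h ^+ 2 * e * W = 9 * (e * W) * h ^+ 2 by ring.
by rewrite ler_wpM2l // ler_peMr ?(ltW h20) //; lra.
Qed.

End Quasimode.

(** * Smooth functions and cutoffs *)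

(** Existence of [n] successive derivatives, with no continuity asked of the last; for all [n]
    together this is smoothness. The recursive form suits induction for sums, products and ODE
    solutions. *)
Fixpoint Ck {R : realType} (n : nat) (f : R -> R) : Prop :=
  if n is m.+1 then exists2 g, (forall x : R, is_derive x 1 f (g x)) & Ck m g
  else True.

Definition smooth {R : realType} (f : R -> R) : Prop := forall n, Ck n f.

Section Smooth.
Context {R : realType}.
Implicit Types (f g q u : R -> R) (x y : R) (n : nat).

Lemma derive1_unique f g : (forall x, is_derive x 1 f (g x)) ->
  (f^`() = g)%classic.
Proof. by move=> dg; apply/funext => x; rewrite derive1E; case: (dg x). Qed.

(** Bridge to the iterated derivatives in [Cc_smooth]. *)
Lemma smoothP f : smooth f <-> forall n x, derivable (f^`(n))%classic x 1.
Proof.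
split=> [fs n|].
  have := fs n.+1; elim: n f {fs} => [|n IH] f [g dg gn] x.
    by rewrite derive1n0; case: (dg x).
  by rewrite derive1Sn (derive1_unique f g dg); apply: IH.
move=> + n; elim: n f => [|n IH] f fd //=; exists (f^`())%classic => [x|].
  by rewrite derive1E; apply: derivableP; exact: (fd 0%N x).
by apply: IH => m x; rewrite -derive1Sn.
Qed.

Lemma Ck_is_derive n f g : (forall x, is_derive x 1 f (g x)) ->
  Ck n.+1 f <-> Ck n g.
Proof.
move=> dg; split=> [[g' dg' g'n]|gn]; last by exists g.
by rewrite -(derive1_unique f g dg) (derive1_unique f g' dg').
Qed.

Lemma CkS n f : Ck n.+1 f -> Ck n f.
Proof.
elim: n f => // n IH f [g dg gn].
by apply/(Ck_is_derive _ _ _ dg); exact: IH.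
Qed.

Lemma Ck_cst n (c : R) : Ck n (fun _ : R => c).
Proof.
elim: n c => // n IH c; exists (fun=> 0) => // x; exact: is_derive_constf.
Qed.

Lemma Ck_add n f g : Ck n f -> Ck n g -> Ck n (fun x => f x + g x).
Proof.
elim: n f g => // n IH f g [f1 df f1n] [g1 dg g1n].
exists (fun x => f1 x + g1 x) => [x|]; first exact: is_derive_addf.
exact: IH.
Qed.

Lemma Ck_mul n f g : Ck n f -> Ck n g -> Ck n (fun x => f x * g x).
Proof.
elim: n f g => // n IH f g fn gn.
have [f1 df f1n] := fn; have [g1 dg g1n] := gn.
exists (fun x => f1 x * g x + f x * g1 x) => [x|]; first exact: is_derive_mulf.
by apply: Ck_add; apply: IH => //; exact: CkS.
Qed.

Lemma Ck_affine n f (c d : R) : Ck n f -> Ck n (fun x => f (c * x + d)).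
Proof.
elim: n f => // n IH f [f1 df f1n].
exists (fun x => f1 (c * x + d) * c) => [x|].
  have daff : is_derive x 1 (fun y : R => c * y + d) c by derive_rules; ring.
  exact: (is_derive_compf (fun y => c * y + d) f).
by apply: Ck_mul; [exact: IH | exact: Ck_cst].
Qed.

Lemma smooth_cst (c : R) : smooth (fun _ : R => c).
Proof. by move=> n; exact: Ck_cst. Qed.

Lemma smooth_add f g : smooth f -> smooth g -> smooth (fun x => f x + g x).
Proof. by move=> fs gs n; exact: Ck_add. Qed.

Lemma smooth_mul f g : smooth f -> smooth g -> smooth (fun x => f x * g x).
Proof. by move=> fs gs n; exact: Ck_mul. Qed.

Lemma smooth_affine f (c d : R) : smooth f -> smooth (fun x => f (c * x + d)).
Proof. by move=> fs n; exact: Ck_affine. Qed.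

Lemma smooth_primitive f g : (forall x, is_derive x 1 f (g x)) ->
  smooth g -> smooth f.
Proof. by move=> dg gs n; apply: CkS; apply/(Ck_is_derive _ _ _ dg). Qed.

Lemma smooth_derivative f g : (forall x, is_derive x 1 f (g x)) ->
  smooth f -> smooth g.
Proof. by move=> dg fs n; apply/(Ck_is_derive _ _ _ dg). Qed.

Lemma smooth_has_derivative f : smooth f ->
  exists2 g, (forall x, is_derive x 1 f (g x)) & smooth g.
Proof.
move=> fs; have [g dg _] := fs 1%N; exists g => //.
exact: smooth_derivative dg fs.
Qed.

(** Bootstrap: [u1] is the derivative of [u], and [q u] that of [u1], so regularity of the pair
    rises one order at a time. *)
Lemma smooth_ode q u (u1 : R -> R) : smooth q -> ode_solution q u u1 ->
  smooth u /\ smooth u1.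
Proof.
move=> qs [du du1].
suff H n : Ck n u /\ Ck n u1 by split=> n; case: (H n).
elim: n => // n [un u1n]; split; first by exists u1.
by exists (fun x => q x * u x) => //; apply: Ck_mul.
Qed.

Lemma supp_bounded f (L : R) : (forall x, L < `|x| -> f x = 0) ->
  compact (supp f).
Proof.
move=> f0; apply: (subclosed_compact _ (@segment_compact R (- L) L)).
  exact: closed_closure.
rewrite (_ : `[- L, L]%classic = closure `[- L, L]%classic).
  apply: closure_subset => x /= fx; rewrite in_itv /= -ler_norml leNgt.
  by apply/negP => /f0 fx0; rewrite fx0 eqxx in fx.
by apply/closure_id; exact: interval_closed.
Qed.

Lemma Cc_smooth_bounded f (L : R) : smooth f ->
  (forall x, L < `|x| -> f x = 0) -> Cc_smooth f.
Proof. by move=> /smoothP fs f0; split=> //; exact: supp_bounded f0. Qed.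

Lemma is_derive_locally_cst f (d : R) (a b x : R) (c : R) : a < x < b ->
  (forall y, a < y < b -> f y = c) -> is_derive x 1 f d -> d = 0.
Proof.
move=> axb fc fd.
have : is_derive x 1 f 0.
  apply: (near_eq_is_derive _ (is_derive_constf c x)).
  near=> y; have : y \in `]a, b[ by near: y; apply: near_in_itvoo; rewrite in_itv.
  by rewrite in_itv => /fc.
by move=> [_ d0]; case: fd => _ <-.
Unshelve. all: by end_near. Qed.

(* A primitive of a nonnegative bump is constant on either side of its support,
   which makes a smooth step. *)
Lemma smooth_step V : smooth V -> (forall x, 0 <= V x) -> 0 < V 0 ->
  (forall x, 5 < `|x| -> V x = 0) ->
  exists s, [/\ smooth s, forall x, x <= - 6 -> s x = 0 &
    forall x, 6 <= x -> s x = 1].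
Proof.
move=> Vs V0 V00 Vsupp.
have [V1 dV _] := smooth_has_derivative V Vs.
have Vc : continuous V by exact: continuous_is_derive dV.
have [T _ dT] := primitive V Vc.
have T_le x y : x <= y -> T x <= T y.
  by move=> xy; apply: (nondecreasing_segment T V).
have T_cst x y : x <= y -> (forall z, x <= z <= y -> 5 < `|z|) -> T x = T y.
  move=> xy H; have := @eq_segment R T (fun=> 0) V x y xy.
  rewrite subrr => E; apply/esym/eqP; rewrite -subr_eq0; apply/eqP.
  by apply: E => z zxy //; rewrite Vsupp ?H //; exact: is_derive_constf.
have T6 : T (- 6) < T 6.
  have le6 : - 6 <= 6 :> R by lra.
  rewrite lt_neqAle T_le // andbT; apply/eqP => TE.
  have TC y : - 6 < y < 6 -> T y = T 6.
    by move=> /andP[/ltW y1 /ltW y2]; apply/eqP; rewrite eq_le -{2}TE !T_le.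
  have x0 : - 6 < (0 : R) < 6 by lra.
  by have := is_derive_locally_cst T (V 0) (- 6) 6 0 (T 6) x0 TC (dT 0); lra.
have dT0 : T 6 - T (- 6) != 0 by rewrite subr_eq0 gt_eqF.
exists (fun x => (T x + - T (- 6)) * (T 6 - T (- 6))^-1); split.
- apply: smooth_mul; last exact: smooth_cst.
  apply: smooth_add; last exact: smooth_cst.
  exact: smooth_primitive dT Vs.
- move=> x x6; rewrite (T_cst x (- 6)) ?subrr ?mul0r // => z /andP[_ z6].
  by rewrite ler0_norm; lra.
- move=> x x6; rewrite -(T_cst 6 x) ?divff // => z /andP[z6 _].
  by rewrite ger0_norm; lra.
Qed.

Lemma smooth_cutoff V (r : R) : 1 < r ->
  smooth V -> (forall x, 0 <= V x) -> 0 < V 0 ->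
  (forall x, 5 < `|x| -> V x = 0) ->
  exists p, [/\ smooth p, forall x, `|x| <= r - 1 / 2 -> p x = 1 &
    forall x, r + 1 / 2 <= `|x| -> p x = 0].
Proof.
move=> r1 Vs V0 V00 Vsupp; have [s [ss s0 s1]] := smooth_step V Vs V0 V00 Vsupp.
(* An ascending step at [- r] times a descending one at [r]; the factor 12 compresses the transition
   zone [[- 6, 6]] of [s] to width 1. *)
exists (fun x => s (- 12 * x + 12 * r) * s (12 * x + 12 * r)); split.
- by apply: smooth_mul; exact: smooth_affine.
- by move=> x; rewrite ler_norml => /andP[x1 x2]; rewrite !s1 ?mulr1 //; lra.
- move=> x; rewrite ler_normr => /orP[x1|x1].
    by rewrite [X in X * _]s0 ?mul0r //; lra.
  by rewrite [X in _ * X]s0 ?mulr0 //; lra.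
Qed.

End Smooth.

(** * L2 norms *)

Section L2Norm.
Context {R : realType}.
Implicit Types (g w : R -> R) (x y a b m N B L : R).
Local Notation mu := (@lebesgue_measure R).
Local Open Scope ereal_scope.

Lemma L2normE g : L2norm g = (\int[mu]_x (g x ^+ 2)%:E) `^ 2^-1.
Proof.
rewrite /L2norm unlock; congr (_ `^ _); apply: eq_integral => x _ /=.
by rewrite powR_mulrn // real_normK // num_real.
Qed.

Lemma integral_sqr_le g B L : (0 <= L)%R -> measurable_fun setT g ->
  (forall x, (`|g x| <= B)%R) -> (forall x, (L < `|x|)%R -> g x = 0%R) ->
  \int[mu]_x (g x ^+ 2)%:E <= (B ^+ 2 * (2 * L))%:E.
Proof.
move=> L0 mg gB g0.
have mg2 D : measurable_fun D (EFin \o (fun x => (g x ^+ 2)%R)).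
  by apply/measurable_EFinP; apply: measurable_funX; exact: measurable_funTS.
have -> : \int[mu]_x (g x ^+ 2)%:E =
    \int[mu]_(x in `[(- L)%R, L]) (g x ^+ 2)%:E.
  rewrite [RHS]integral_mkcond; apply: eq_integral => x _; rewrite patchE.
  case: ifPn => // /negP xL; rewrite g0 ?expr0n //.
  rewrite ltNge; apply/negP => Lx; apply: xL.
  by rewrite inE /= in_itv /= -ler_norml.
have -> : (B ^+ 2 * (2 * L))%:E =
    \int[mu]_(x in `[(- L)%R, L]) (cst (B ^+ 2)%:E) x.
  rewrite integral_cst //= lebesgue_measure_itv /= lte_fin.
  case: ltP => [_|LL]; first by rewrite -EFinD -EFinM; congr (_ %:E); ring.
  by have -> : L = 0%R by [lra]; rewrite !mulr0 mule0.
apply: ge0_le_integral => //.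
- by move=> x _; rewrite lee_fin sqr_ge0.
- exact: mg2.
- move=> x _ /=; rewrite lee_fin -(real_normK (num_real (g x))).
  by rewrite lerXn2r // ?nnegrE // (le_trans _ (gB x)).
Qed.

Lemma integral_sqr_ge g m a b : (0 <= m)%R -> (a < b)%R -> measurable_fun setT g ->
  (forall x, (a <= x <= b)%R -> (m <= g x ^+ 2)%R) ->
  (m * (b - a))%:E <= \int[mu]_x (g x ^+ 2)%:E.
Proof.
move=> m0 ab mg gm.
have mg2 D : measurable_fun D (EFin \o (fun x => (g x ^+ 2)%R)).
  by apply/measurable_EFinP; apply: measurable_funX; exact: measurable_funTS.
apply: (@le_trans _ _ (\int[mu]_(x in `[a, b]) (g x ^+ 2)%:E)); last first.
  apply: ge0_subset_integral => //; first exact: mg2.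
  by move=> x _; rewrite lee_fin sqr_ge0.
have -> : (m * (b - a))%:E = \int[mu]_(x in `[a, b]) (cst m%:E) x.
  by rewrite integral_cst //= lebesgue_measure_itv /= lte_fin ab -EFinD -EFinM.
by apply: ge0_le_integral => //; exact: mg2.
Qed.

Lemma L2norm_le g B L : (0 <= L)%R -> (0 <= B)%R -> measurable_fun setT g ->
  (forall x, (`|g x| <= B)%R) -> (forall x, (L < `|x|)%R -> g x = 0%R) ->
  L2norm g <= (B * Num.sqrt (2 * L))%:E.
Proof.
move=> L0 B0 mg gB g0; rewrite L2normE.
have H := integral_sqr_le _ _ _ L0 mg gB g0.
apply: le_trans (_ : _ <= (B ^+ 2 * (2 * L))%:E `^ 2^-1) _.
  apply: gt0_ler_poweR => //; rewrite ?in_itv /= ?leey ?andbT //.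
  - by apply: integral_ge0 => x _; rewrite lee_fin sqr_ge0.
  - by rewrite lee_fin !mulr_ge0 ?sqr_ge0.
rewrite poweR_EFin powR12_sqrt; last by rewrite !mulr_ge0 ?sqr_ge0.
by rewrite lee_fin sqrtrM ?sqr_ge0 // sqrtr_sqr ger0_norm.
Qed.

(** [N] is the reciprocal of the norm of [g]. The bound and the support make that norm finite; the
    lower bound on [[a, b]] makes it positive and limits [N]. *)
Lemma L2norm_normalize g m a b L B : (0 < m)%R -> (a < b)%R -> (0 <= L)%R ->
  measurable_fun setT g -> (forall x, (`|g x| <= B)%R) ->
  (forall x, (L < `|x|)%R -> g x = 0%R) ->
  (forall x, (a <= x <= b)%R -> (m <= g x ^+ 2)%R) ->
  exists2 N, (0 <= N)%R & (N ^+ 2 * (m * (b - a)) <= 1)%R /\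
    L2norm (fun x => (N * g x)%R) = 1.
Proof.
move=> m0 ab L0 mg gB g0 gm.
have H1 := integral_sqr_le _ _ _ L0 mg gB g0.
have H2 := integral_sqr_ge _ _ _ _ (ltW m0) ab mg gm.
have I0 : 0 <= \int[mu]_x (g x ^+ 2)%:E.
  by apply: integral_ge0 => x _; rewrite lee_fin sqr_ge0.
have Ifin : \int[mu]_x (g x ^+ 2)%:E \is a fin_num.
  by rewrite ge0_fin_numE // (le_lt_trans H1) // ltry.
set I := \int[mu]_x (g x ^+ 2)%:E in H1 H2 I0 Ifin.
have IE : I = (fine I)%:E by rewrite fineK.
set Q := fine I in IE.
have Qm : (m * (b - a) <= Q)%R by rewrite -lee_fin -IE.
have mab : (0 < m * (b - a))%R by rewrite mulr_gt0 // subr_gt0.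
have Q0 : (0 < Q)%R by exact: lt_le_trans Qm.
have NQ : ((Num.sqrt Q)^-1 ^+ 2 = Q^-1)%R by rewrite exprVn sqr_sqrtr // ltW.
exists (Num.sqrt Q)^-1%R; first by rewrite invr_ge0 sqrtr_ge0.
split; first by rewrite NQ mulrC ler_pdivrMr // mul1r.
rewrite L2normE.
have -> : \int[mu]_x (((Num.sqrt Q)^-1 * g x) ^+ 2)%:E = 1.
  have -> : \int[mu]_x (((Num.sqrt Q)^-1 * g x) ^+ 2)%:E =
      \int[mu]_x ((Q^-1)%:E * (g x ^+ 2)%:E).
    by apply: eq_integral => x _; rewrite exprMn NQ EFinM.
  rewrite ge0_integralZl_EFin //.
  - by rewrite -/I IE -EFinM mulVf // gt_eqF.
  - by move=> x _; rewrite lee_fin sqr_ge0.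
  - by apply/measurable_EFinP; exact: measurable_funX.
  - by rewrite invr_ge0 ltW.
by rewrite poweR1r.
Qed.

End L2Norm.

(** * The quasimode *)

Section Cutoff.
Context {R : realType}.
Implicit Types (f u p V : R -> R) (x y h : R).

Lemma bounded_segment f (a b : R) : a <= b -> continuous f ->
  exists2 M, 0 <= M & forall x, a <= x <= b -> `|f x| <= M.
Proof.
move=> ab fc.
have nfc : {within `[a, b], continuous (fun x => `|f x|)}.
  apply: continuous_subspaceT => x; apply: continuous_comp; first exact: fc.
  exact: norm_continuous.
have [z _ zM] := EVT_max ab nfc.
by exists `|f z| => // x xab; apply: zM; rewrite in_itv.
Qed.

Lemma bounded_compact_support f (L : R) : 0 <= L -> continuous f ->
  (forall x, L < `|x| -> f x = 0) ->
  exists2 M, 0 <= M & forall x, `|f x| <= M.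
Proof.
move=> L0 fc f0; have [|M M0 fM] := bounded_segment f (- L) L _ fc; first lra.
exists M => // x; have [Lx|xL] := ltP L `|x|; first by rewrite f0 // normr0.
by apply: fM; rewrite -ler_norml.
Qed.

Lemma derivative_support f (g : R -> R) (L : R) :
  (forall x, is_derive x 1 f (g x)) -> (forall x, L < `|x| -> f x = 0) ->
  forall x, L < `|x| -> g x = 0.
Proof.
move=> dg f0 x; rewrite ltr_normr => /orP[Lx|Lx].
  apply: (is_derive_locally_cst f (g x) L (x + 1) x 0) => //.
    by rewrite Lx ltrDl ltr01.
  by move=> y /andP[Ly _]; rewrite f0 // ltr_normr Ly.
apply: (is_derive_locally_cst f (g x) (x - 1) (- L) x 0) => //; first lra.
by move=> y /andP[_ Ly]; rewrite f0 // ltr_normr; apply/orP; right; lra.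
Qed.

Lemma derivative_locally_cst f (g : R -> R) (L c : R) :
  (forall x, is_derive x 1 f (g x)) -> (forall x, `|x| < L -> f x = c) ->
  forall x, `|x| < L -> g x = 0.
Proof.
move=> dg fc x; rewrite ltr_norml => xL.
apply: (is_derive_locally_cst f (g x) (- L) L x c) => // y yL.
by apply: fc; rewrite ltr_norml.
Qed.

Lemma derive1n2_unique f (f1 f2 : R -> R) : (forall x, is_derive x 1 f (f1 x)) ->
  (forall x, is_derive x 1 f1 (f2 x)) -> (f^`(2))%classic = f2.
Proof.
move=> df df1; rewrite derive1Sn derive1n1 (derive1_unique f f1 df).
exact: derive1_unique.
Qed.

Lemma smooth_continuous f : smooth f -> continuous f.
Proof.
by move=> /smooth_has_derivative[g dg _]; exact: continuous_is_derive dg.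
Qed.

(* [(P - E) (p u) = [P, p] u] *)
Lemma schrodinger_cutoff V h (E N : R) p (p1 p2 : R -> R) u (u1 : R -> R) x :
  h != 0 -> (forall x, is_derive x 1 p (p1 x)) ->
  (forall x, is_derive x 1 p1 (p2 x)) ->
  ode_solution (reduced_potential V h E) u u1 ->
  schrodinger h V (fun x => N * (p x * u x)) x - E * (N * (p x * u x)) =
  - (h ^+ 2 * N * (2 * p1 x * u1 x + p2 x * u x)).
Proof.
move=> h0 dp dp1 [du du1].
have dU y : is_derive y 1 (fun x => N * (p x * u x))
    (N * (p1 y * u y + p y * u1 y)) by derive_rules; ring.
have dU1 y : is_derive y 1 (fun x => N * (p1 x * u x + p x * u1 x))
    (N * (p2 y * u y + 2 * p1 y * u1 y +
      p y * (reduced_potential V h E y * u y))) by derive_rules; ring.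
rewrite /schrodinger (derive1n2_unique _ _ _ dU dU1).
by rewrite /reduced_potential; field.
Qed.

End Cutoff.

(** Explicit values give [V <= 7/8] on [[25/8, 7/2]], compactness gives a maximum below 1 on
    [[7/2, 5]], and [V] vanishes beyond 5. *)
Lemma potential_bounds {R : realType} (V : R -> R) : continuous V ->
  (forall x, 2 <= x <= 7 / 2 -> V x = 4 - x) ->
  (forall x, 3 < x -> V x < 1) -> (forall x, 5 < `|x| -> V x = 0) ->
  exists2 c, 0 < c & forall x, 25 / 8 <= x -> V x <= 1 - c.
Proof.
move=> Vc Vslope Vlt1 Vsupp.
have [||z zI zM] := @EVT_max R V (7 / 2) 5; first lra.
  exact: continuous_subspaceT.
have Vz : V z < 1 by apply: Vlt1; move: zI; rewrite in_itv /=; lra.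
exists (Num.min (1 / 8) (1 - V z)).
  by rewrite lt_min subr_gt0 Vz divr_gt0.
move=> x x0; have m1 : Num.min (1 / 8) (1 - V z) <= 1 / 8 by rewrite ge_min lexx.
have m2 : Num.min (1 / 8) (1 - V z) <= 1 - V z by rewrite ge_min lexx orbT.
have [x1|/ltW x1] := leP x (7 / 2); first by rewrite Vslope; lra.
have [x2|x2] := leP x 5.
  by have := zM x; rewrite in_itv /= x1 x2 => /(_ isT); lra.
by rewrite Vsupp ?gtr0_norm //; lra.
Qed.

(** [U] is [p u] normalised on [|x| < 4], and [F] is the commutator term, which lives where [p] is
    not locally constant. Normalisation contributes [exp (- 5 / (16 h))] to [F^2] and the outer
    bounds contribute [exp (4 / (16 h))]. *)
Lemma cutoff_quasimode {R : realType} (V : R -> R) (B h E A D r : R)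
    (u u1 p p1 p2 : R -> R) :
  smooth V -> (forall x, V (- x) = V x) -> (forall x, `|V x| <= B) ->
  5 < r -> 0 < h -> h <= 1 -> 0 < A ->
  ode_solution (reduced_potential V h E) u u1 -> u 0 = 0 \/ u1 0 = 0 ->
  (forall x, 2 <= x <= 17 / 8 -> expR (5 / (16 * h)) / 64 <= u x ^+ 2) ->
  (forall x, 25 / 8 <= x <= r + 1 -> u x ^+ 2 <= A * expR (4 / (16 * h)) /\
    u1 x ^+ 2 <= A * expR (4 / (16 * h))) ->
  smooth p -> (forall x : R, is_derive x 1 p (p1 x)) ->
  (forall x : R, is_derive x 1 p1 (p2 x)) ->
  (forall x, `|x| <= r - 1 / 2 -> p x = 1) ->
  (forall x, r + 1 / 2 <= `|x| -> p x = 0) ->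
  (forall x, `|p1 x| <= D) -> (forall x, `|p2 x| <= D) ->
  exists U F : R -> R,
    [/\ Cc_smooth U /\ Cc_smooth F,
        forall x, schrodinger h V U x - E * U x = F x,
        F = (\1_[set x : R | (r - 1 < `|x| < r + 1)%R] : R -> R) \* F,
        L2norm ((\1_[set x : R | (`|x| < 4)%R] : R -> R) \* U) = 1%E &
        (L2norm F <= (Num.sqrt (10 * (64 * 8) * D ^+ 2 * A * (2 * (r + 1))) *
          expR (- (1 / (32 * h))))%:E)%E].
Proof.
move=> Vs Ve VB r5 h0 h1 A0 su u0 ulow uup ps dp dp1 pin pout p1D p2D.
have hn0 : h != 0 by rewrite gt_eqF.
have h20 : 0 < h ^+ 2 by rewrite exprn_gt0.
pose q := reduced_potential V h E.
have qs : smooth q.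
  by apply: smooth_mul; [apply: smooth_add => //|]; exact: smooth_cst.
have qe x : q (- x) = q x by rewrite /q /reduced_potential Ve.
have qK x : `|q x| <= (B + `|E|) / h ^+ 2.
  rewrite /q /reduced_potential normrM normfV (gtr0_norm h20).
  by rewrite ler_pM2r ?invr_gt0 // (le_trans (ler_normB _ _)) // lerD2r.
(* Either condition at 0 gives [u] a parity, so the squares are even and the bounds known for
   positive [x] transfer to negative [x]. *)
have parity x : u (- x) ^+ 2 = u x ^+ 2 /\ u1 (- x) ^+ 2 = u1 x ^+ 2.
  case: u0 => [u00|u10].
    by have [-> ->] := ode_odd q u u1 _ qe qK su u00 x; rewrite sqrrN.
  by have [-> ->] := ode_even q u u1 _ qe qK su u10 x; rewrite sqrrN.
have [us u1s] := smooth_ode q u u1 qs su.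
have pout' x : r + 1 / 2 < `|x| -> p x = 0 by move=> xr; apply: pout; exact: ltW.
have p1out := derivative_support _ _ _ dp pout'.
have p2out := derivative_support _ _ _ dp1 p1out.
have pin' x : `|x| < r - 1 / 2 -> p x = 1 by move=> xr; apply: pin; exact: ltW.
have p1in := derivative_locally_cst _ _ _ _ dp pin'.
have p2in := derivative_locally_cst _ _ _ _ dp1 p1in.
pose w x := p x * u x.
have ws : smooth w by exact: smooth_mul.
have wc := smooth_continuous w ws.
have w0 x : r + 1 / 2 < `|x| -> w x = 0 by move=> /pout' px; rewrite /w px mul0r.
have [|Mw Mw0 wM] := bounded_compact_support w (r + 1 / 2) _ wc w0; first lra.
pose chi : R -> R := \1_[set x : R | `|x| < 4].
have chi_in x : `|x| < 4 -> chi x = 1 by move=> x4; rewrite /chi indicE mem_set.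
have chi_out x : 4 <= `|x| -> chi x = 0.
  by move=> x4; rewrite /chi indicE memNset //= => ?; lra.
have chi_meas : measurable_fun setT chi.
  apply: measurable_indic.
  rewrite (_ : [set x : R | `|x| < 4] = `](- 4), 4[%classic).
    exact: measurable_itv.
  by apply/seteqP; split=> x; rewrite /= in_itv /= ltr_norml.
pose g x := chi x * w x.
have g_meas : measurable_fun setT g.
  by apply: measurable_funM => //; exact: continuous_measurable_fun.
have gM x : `|g x| <= Mw.
  rewrite /g; have [x4|x4] := ltP `|x| 4; first by rewrite chi_in // mul1r.
  by rewrite chi_out // mul0r normr0.
have g_supp x : 4 < `|x| -> g x = 0.
  by move=> x4; rewrite /g chi_out ?mul0r // ltW.
have gE x : `|x| < 4 -> g x = u x.
  by move=> x4; rewrite /g /w chi_in // pin ?mul1r //; lra.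
pose m := expR (5 / (16 * h)) / 64.
have m0 : 0 < m by rewrite divr_gt0 ?expR_gt0.
have glow x : 2 <= x <= 17 / 8 -> m <= g x ^+ 2.
  move=> xI; rewrite gE; first exact: ulow.
  by clear - xI; rewrite ger0_norm; lra.
have le24 : 2 < 17 / 8 :> R by lra.
have [N N0 [Nm gN]] :=
  L2norm_normalize g m 2 (17 / 8) 4 Mw m0 le24 (ler0n _ 4) g_meas gM g_supp glow.
pose U x := N * w x.
pose F x := - (h ^+ 2 * N * (2 * p1 x * u1 x + p2 x * u x)).
have Us : smooth U by apply: smooth_mul => //; exact: smooth_cst.
have p1s := smooth_derivative _ _ dp ps.
have p2s := smooth_derivative _ _ dp1 p1s.
have FE : F = fun x => - (h ^+ 2 * N) * (2 * (p1 x * u1 x) + p2 x * u x).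
  by apply/funext => x; rewrite /F; ring.
have Fs : smooth F.
  rewrite FE; apply: smooth_mul; first exact: smooth_cst.
  apply: smooth_add; last exact: smooth_mul.
  by apply: smooth_mul; [exact: smooth_cst | exact: smooth_mul].
have Fout x : r + 1 / 2 < `|x| -> F x = 0.
  by move=> xr; rewrite /F p1out // p2out //; ring.
have Fin x : `|x| < r - 1 / 2 -> F x = 0.
  by move=> xr; rewrite /F p1in // p2in //; ring.
exists U, F; split.
- split; first apply: (Cc_smooth_bounded _ (r + 1 / 2)) => // x xr.
    by rewrite /U w0 // mulr0.
  exact: (Cc_smooth_bounded _ (r + 1 / 2)).
- by move=> x; exact: schrodinger_cutoff.
- apply/funext => x /=; have [xr|xr] := ltP `|x| (r - 1 / 2).
    by rewrite Fin // mulr0.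
  have [xr'|xr'] := ltP (r + 1 / 2) `|x|; first by rewrite Fout // mulr0.
  rewrite indicE mem_set /= ?mul1r //.
  by apply/andP; clear - xr xr'; split; lra.
- rewrite -gN; congr L2norm; apply/funext => x /=.
  by rewrite -/chi /U /g; ring.
(* [64 * 8] comes from [N^2], since [u^2] is bounded below on an interval of length 1/8, and
   [10 = 2 * (4 + 1)] from squaring the sum [2 p' u' + p'' u]. *)
set K := 10 * (64 * 8) * D ^+ 2 * A.
have D0 : 0 <= D by exact: le_trans (p1D 0).
have K0 : 0 <= K by rewrite !mulr_ge0 ?sqr_ge0 // ltW.
pose Bf := Num.sqrt K * expR (- (1 / (32 * h))).
have Bf0 : 0 <= Bf by rewrite mulr_ge0 ?sqrtr_ge0 ?expR_ge0.
have Bf2 : Bf ^+ 2 = K * expR (4 / (16 * h)) / expR (5 / (16 * h)).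
  rewrite exprMn sqr_sqrtr // -expRM_natl -mulrA -expRB.
  by congr (_ * expR _); field.
have FB x : `|F x| <= Bf.
  have [xr|xr] := ltP `|x| (r - 1 / 2); first by rewrite Fin // normr0.
  have [xr'|xr'] := ltP (r + 1 / 2) `|x|; first by rewrite Fout // normr0.
  have [ux u1x] : u x ^+ 2 <= A * expR (4 / (16 * h)) /\
      u1 x ^+ 2 <= A * expR (4 / (16 * h)).
    have [x0|x0] := leP 0 x.
      by apply: uup; move: xr xr'; rewrite ger0_norm //; clear - r5; lra.
    have [<- <-] := parity x; apply: uup; move: xr xr'; rewrite ltr0_norm //.
    by clear - r5; lra.
  rewrite -ler_sqr ?nnegrE // real_normK ?num_real // Bf2.
  set e := expR (4 / (16 * h)) in ux u1x *; set e5 := expR (5 / (16 * h)).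
  have e50 : 0 < e5 by exact: expR_gt0.
  have N2 : N ^+ 2 <= 64 * 8 / e5.
    rewrite ler_pdivlMr //; move: Nm; rewrite /m -/e5.
    have -> : N ^+ 2 * (e5 / 64 * (17 / 8 - 2)) = N ^+ 2 * e5 / (64 * 8) by field.
    by rewrite ler_pdivrMr // mul1r.
  have sqD y : `|y| <= D -> y ^+ 2 <= D ^+ 2.
    by move=> yD; rewrite -(real_normK (num_real y)) lerXn2r // ?nnegrE.
  have p1x := sqD _ (p1D x); have p2x := sqD _ (p2D x).
  have Pu1 : p1 x ^+ 2 * u1 x ^+ 2 <= D ^+ 2 * (A * e) by rewrite ler_pM ?sqr_ge0.
  have Pu : p2 x ^+ 2 * u x ^+ 2 <= D ^+ 2 * (A * e) by rewrite ler_pM ?sqr_ge0.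
  have S : (2 * p1 x * u1 x + p2 x * u x) ^+ 2 <= 10 * (D ^+ 2 * (A * e)).
    have := sqr_ge0 (2 * p1 x * u1 x - p2 x * u x).
    move: Pu Pu1; rewrite -!exprMn; clear; nra.
  have -> : F x ^+ 2 = h ^+ 4 * N ^+ 2 * (2 * p1 x * u1 x + p2 x * u x) ^+ 2.
    by rewrite /F; ring.
  have -> : K * e / e5 = 1 * (64 * 8 / e5) * (10 * (D ^+ 2 * (A * e))).
    by rewrite /K; field; rewrite gt_eqF.
  have h40 : 0 <= h ^+ 4 by rewrite exprn_ge0 // ltW.
  have h41 : h ^+ 4 <= 1 by rewrite exprn_ile1 // ltW.
  have N20 := sqr_ge0 N.
  have hN : h ^+ 4 * N ^+ 2 <= 1 * (64 * 8 / e5) by exact: ler_pM.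
  by apply: ler_pM => //; [exact: mulr_ge0 | exact: sqr_ge0].
have r1 : 0 <= r + 1 by clear - r5; lra.
have Fm : measurable_fun setT F.
  by apply: continuous_measurable_fun; exact: smooth_continuous.
have := L2norm_le F Bf (r + 1) r1 Bf0 Fm FB.
have -> : Bf * Num.sqrt (2 * (r + 1)) =
    Num.sqrt (K * (2 * (r + 1))) * expR (- (1 / (32 * h))).
  by rewrite (sqrtrM _ K0) /Bf; ring.
by apply=> x xr; rewrite Fout //; clear - xr; lra.
Qed.

Lemma near0_right_lt {R : realType} (M : R) : 0 <= M ->
  \forall h \near (0 : R)^'+, 0 < h /\ M * h < 1.
Proof.
move=> M0; have M1 : 0 < M + 1 by rewrite ltr_wpDl.
have M1V : 0 < (M + 1)^-1 by rewrite invr_gt0.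
near=> h.
have h0 : 0 < h by near: h; exact: nbhs_right_gt.
have hM : h < (M + 1)^-1 by near: h; exact: (nbhs_right_lt M1V).
split=> //; apply: le_lt_trans (_ : (M + 1) * h < 1).
  by rewrite ler_pM2r // lerDl.
by rewrite -ltr_pdivlMl // mulr1.
Unshelve. all: by end_near. Qed.

Theorem theorem1 (R : realType) (V : R -> R) (r : R)
  (V_smooth : Cc_smooth V)
  (V_ge0 : forall x : R, 0 <= V x)
  (V_even : forall x : R, V x = V (- x))
  (V_well : forall x : R, -1 <= x <= 1 -> V x = x ^+ 2 + 1)
  (V_slope : forall x : R, 2 <= x <= 7 / 2 -> V x = 4 - x)
  (V_lt1 : forall x : R, 3 < x -> V x < 1)
  (V_supp : supp V `<=` [set x : R | -5 <= x <= 5])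
  (r_gt5 : 5 < r) :
  let R0 : R := 4 in
  let chi : R -> R := \1_[set x : R | `|x| < R0] in
  let psi : R -> R := \1_[set x : R | r - 1 < `|x| < r + 1] in
  exists (c : R) (E0 : R -> R) (u f : R -> R -> R),
    [/\ 0 < c,
        E0 = cst 1 +O_ (0^'+) id &
        \forall h \near 0^'+,
          [/\ Cc_smooth (u h) /\ Cc_smooth (f h),
              forall x : R, schrodinger h V (u h) x - E0 h * u h x = f h x,
              f h = psi \* f h,
              L2norm (chi \* u h) = 1%E &
              (L2norm (f h) <= (expR (- c / h))%:E)%E]].
Proof.
move=> R0 chi psi.
have Vs : smooth V by apply/smoothP; exact: V_smooth.1.
have V0 x : 5 < `|x| -> V x = 0.
  move=> x5; apply/eqP; apply: contraTT x5 => Vx0.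
  have : supp V x by apply: subset_closure.
  by move=> /V_supp /=; rewrite -ler_norml leNgt.
have le05 : 0 <= 5 :> R by lra.
have Vc := smooth_continuous V Vs.
have [V1 dV V1s] := smooth_has_derivative V Vs.
have [B B0 VB] := bounded_compact_support V 5 le05 Vc V0.
have [C C0 V1C] := bounded_compact_support V1 5 le05 (smooth_continuous V1 V1s)
  (derivative_support V V1 5 dV V0).
have [c c0 Vle] := potential_bounds V Vc V_slope V_lt1 V0.
have VB' x : 0 <= V x <= B.
  by rewrite V_ge0 /= (le_trans (ler_norm _) (VB x)).
have [A A0 tunnel] := tunnelling_solution V V1 B C c (r + 1) VB' dV V1C V_well
  V_slope c0 Vle.
have V00 : 0 < V 0 by rewrite V_well; lra.
have [|p [ps pin pout]] := smooth_cutoff V r _ Vs V_ge0 V00 V0; first lra.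
have [p1 dp p1s] := smooth_has_derivative p ps.
have [p2 dp1 p2s] := smooth_has_derivative p1 p1s.
have pout' x : r + 1 / 2 < `|x| -> p x = 0 by move=> xr; apply: pout; exact: ltW.
have p1out := derivative_support _ _ _ dp pout'.
have p2out := derivative_support _ _ _ dp1 p1out.
have r0 : 0 <= r + 1 / 2 by lra.
have [D1 D10 p1D] := bounded_compact_support p1 _ r0
  (smooth_continuous p1 p1s) p1out.
have [D2 D20 p2D] := bounded_compact_support p2 _ r0
  (smooth_continuous p2 p2s) p2out.
pose D := D1 + D2.
have p1D' x : `|p1 x| <= D by apply: le_trans (p1D x) _; rewrite /D lerDl.
have p2D' x : `|p2 x| <= D by apply: le_trans (p2D x) _; rewrite /D lerDr.
pose K := Num.sqrt (10 * (64 * 8) * D ^+ 2 * A * (2 * (r + 1))).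
have K0 : 0 <= K by exact: sqrtr_ge0.
have /choice[E /choice[u /choice[f Huf]]] : forall h, exists E u f,
    0 < h -> 200 * 200 * h < 1 -> [/\ 1 <= E <= 1 + 2 * h,
      [/\ Cc_smooth u /\ Cc_smooth f,
          forall x : R, schrodinger h V u x - E * u x = f x,
          f = psi \* f & L2norm (chi \* u) = 1%E] &
      (L2norm f <= (K * expR (- (1 / (32 * h))))%:E)%E].
  (* Outside the range of small [h] nothing is claimed, and dummy values are supplied. *)
  move=> h; have [h0|h0] := boolP (0 < h); last by exists 0, V, V.
  have [hs|hs] := boolP (200 * 200 * h < 1); last by exists 0, V, V.
  have [E [u [u1 [EI su u0 ulow uup]]]] := tunnel h h0 hs.
  have h1 : h <= 1 by clear - h0 hs; lra.
  have Ve x : V (- x) = V x by rewrite -V_even.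
  have [u' [f [s1 s2 s3 s4 s5]]] := cutoff_quasimode V B h E A D r u u1 p p1 p2
    Vs Ve VB r_gt5 h0 h1 A0 su u0 ulow uup ps dp dp1 pin pout p1D' p2D'.
  by exists E, u', f.
have near_small : \forall h \near (0 : R)^'+,
    [/\ 0 < h, 200 * 200 * h < 1 & 64 * (K + 1) * h < 1].
  have [A1 A2] : 0 <= 200 * 200 :> R /\ 0 <= 64 * (K + 1).
    by split; apply: mulr_ge0; rewrite ?ler0n ?addr_ge0.
  by apply: filterS2 (near0_right_lt _ A1) (near0_right_lt _ A2) => h [? ?] [].
(* Half of the available exponent [1 / (32 h)] is spent on the constant: for small [h],
   [K <= 1 / (64 h) <= exp (1 / (64 h))]. *)
exists (1 / 64), E, u, f; split.
- by rewrite divr_gt0.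
- apply/eqaddOP; near=> k; apply: filterS near_small => h [h0 hs _].
  have [/andP[E1 E2] _ _] := Huf h h0 hs.
  have -> : (E - cst 1) h = E h - 1 by [].
  rewrite (gtr0_norm h0) ger0_norm ?subr_ge0 //.
  apply: le_trans (_ : 2 * h <= _); first by clear - E2; lra.
  by rewrite ler_pM2r //; near: k; exact: nbhs_pinfty_ge.
- apply: filterS near_small => h [h0 hs hK].
  have [_ [s1 s2 s3 s4] s5] := Huf h h0 hs.
  split=> //; apply: le_trans s5 _; rewrite lee_fin.
  have hn0 : h != 0 by rewrite gt_eqF.
  pose t := 1 / (64 * h).
  have -> : - (1 / (32 * h)) = - t + - t by rewrite /t; field.
  have -> : - (1 / 64) / h = - t by rewrite /t; field.
  have Kt : K <= expR t.
    apply: le_trans (_ : t <= _).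
      by rewrite /t ler_pdivlMr ?mulr_gt0 //; clear - h0 hK; lra.
    by have := expR_ge1Dx t; clear; lra.
  rewrite expRD mulrA -[X in _ <= X]mul1r ler_wpM2r ?expR_ge0 //.
  by rewrite expRN ler_pdivrMr ?expR_gt0 // mul1r.
Unshelve. all: by end_near. Qed.
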